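(* Let $X, X_1, Y, Y_1$ be Banach spaces (over the same scalar field) and let $A:X\to X_1$ and $B:Y\to Y_1$ be non-zero (bounded, linear) operators. Then $$Sz(A\otimes B)=\max\{Sz(A),Sz(B)\},$$ where $A\otimes B:X\hat{\otimes}_\varepsilon Y\to X_1\hat{\otimes}_\varepsilon Y_1$ is the induced operator on injective tensor products. In particular, for any non-zero Banach spaces $X,Y$, $Sz(X\hat{\otimes}_\varepsilon Y)=\max\{Sz(X),Sz(Y)\}$.
   Context: Scalars are real or complex. For a Banach space $X$, a weak*-compact $K\subset X^*$ and $\varepsilon>0$, let $s_\varepsilon(K)$ be the set of all $x^*\in K$ such that for every weak*-neighborhood $V$ of $x^*$, $\mathrm{diam}(V\cap K)>\varepsilon$ (norm diameter). Define $s^0_\varepsilon(K)=K$, $s^{\xi+1}_\varepsilon(K)=s_\varepsilon(s^\xi_\varepsilon(K))$, and $s^\xi_\varepsilon(K)=\bigcap_{\zeta<\xi}s^\zeta_\varepsilon(K)$ for limit $\xi$. Let $Sz_\varepsilon(K)=\min\{\xi: s^\xi_\varepsilon(K)=\varnothing\}$ if such an ordinal exists, $Sz_\varepsilon(K)=\infty$ otherwise, and $Sz(K)=\sup_{\varepsilon>0}Sz_\varepsilon(K)$ ($=\infty$ if some $Sz_\varepsilon(K)=\infty$); $\xi<\infty$ for every ordinal $\xi$. For a Banach space $X$, $Sz(X)=Sz(B_{X^*})$, and for an operator $A:X\to Y$, $Sz(A)=Sz(A^*B_{Y^*})$. For $x\in X$, $y\in Y$, let $x\otimes y:Y^*\to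 X$ be the operator $(x\otimes y)(y^* )=y^*(y)x$. The injective tensor product $X\hat{\otimes}_\varepsilon Y$ is the norm closure in the space $L(Y^*,X)$ of bounded operators of $X\otimes Y=\{\sum_{i=1}^n x_i\otimes y_i: n\in\mathbb{N},x_i\in X,y_i\in Y\}$. The operator $A\otimes B$ is the unique continuous linear extension of $\sum_{i=1}^n x_i\otimes y_i\mapsto\sum_{i=1}^n Ax_i\otimes By_i$. *)

(* Defs.v *)
From HB Require Import structures.
From mathcomp Require Import all_boot all_order all_algebra.
From mathcomp Require Import complex.
From mathcomp Require Import all_classical all_reals all_analysis.

Set Implicit Arguments.
Unset Strict Implicit.
Unset Printing Implicit Defensive.
Import Order.TTheory GRing.Theory Num.Theory.
Import numFieldNormedType.Exports.
Local Open Scope classical_set_scope.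
Local Open Scope ring_scope.

(* [Node f] denotes the least ordinal strictly above all those denoted by the
   [f i]; every ordinal has such a notation, but not a unique one. *)
Inductive onote : Type := Node (T : Type) (f : T -> onote).

Fixpoint nle (s t : onote) {struct s} : Prop :=
  match s, t with Node T f, Node U g => forall i, exists j, nle (f i) (g j) end.

Definition nlt (s t : onote) : Prop :=
  match t with Node U g => exists j, nle s (g j) end.

Lemma nle_refl s : nle s s.
Proof. by elim: s => I f IH i; exists i; exact: IH. Qed.

Lemma nle_trans s t u : nle s t -> nle t u -> nle s u.
Proof.
elim: s t u => I f IH [J g] [L h] st tu i.
have [j fg] := st i; have [l gh] := tu j; exists l; exact: IH fg gh.
Qed.

Lemma nlt_le_trans s t u : nlt s t -> nle t u -> nlt s u.
Proof.
case: t u => [J g] [L h] [j sj] tu.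
by have [l gl] := tu j; exists l; exact: nle_trans sj gl.
Qed.

Lemma nle_lt_trans s t u : nle s t -> nlt t u -> nlt s u.
Proof. by case: u => L h st [l tl]; exists l; exact: nle_trans st tl. Qed.

Lemma nltnn s : ~ nlt s s.
Proof.
elim: s => I f IH [i sfi]; apply: (IH i).
by apply: nlt_le_trans sfi; exists i; exact: nle_refl.
Qed.

Lemma nle_or_lt s t : nle s t \/ nlt t s.
Proof.
elim: s t => I f IH [J g].
have [|/existsNP[i fi]] := pselect (forall i, exists j, nle (f i) (g j)).
  by left.
right; exists i; case E : (f i) => [L h] /= j.
have [|] := IH i (g j); first by move=> ?; case: fi; exists j.
by rewrite E.
Qed.

Lemma nlt_wf : well_founded nlt.
Proof.
suff H t s : nle s t -> Acc nlt s by move=> s; exact: H (nle_refl s).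
elim: t s => J g IH s st; constructor=> r rs.
by have [j rj] : nlt r (Node g) := nlt_le_trans rs st; exact: IH rj.
Qed.

(* An ordinal is a class of notations, encoded by the set of notations of
   ordinals at most equal to it, so that [=] is equality of ordinals. *)
Record Ord : Type :=
  MkOrd { below : onote -> Prop; belowP : exists t, below = nle^~ t }.

Definition ord_of (t : onote) : Ord := MkOrd (ex_intro _ t erefl).

Definition ole (a b : Ord) : Prop := forall t, below a t -> below b t.
Definition olt (a b : Ord) : Prop := ole a b /\ a <> b.

Lemma ord_ofP a : exists t, a = ord_of t.
Proof.
case: a => A [t tE]; exists t; subst A.
by rewrite /ord_of; congr MkOrd; exact: Prop_irrelevance.
Qed.

Lemma ole_of s t : ole (ord_of s) (ord_of t) <-> nle s t.
Proof.
split=> [/(_ s (nle_refl s))//|st r /= rs]; exact: nle_trans rs st.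
Qed.

Lemma ole_refl a : ole a a. Proof. by []. Qed.

Lemma ole_trans a b c : ole a b -> ole b c -> ole a c.
Proof. by move=> ab bc t /ab /bc. Qed.

Lemma ole_anti a b : ole a b -> ole b a -> a = b.
Proof.
case: a b => [A hA] [B hB] /= AB BA.
have E : A = B by apply/funext => t; apply/propext; split=> [/AB|/BA].
by subst B; congr MkOrd; exact: Prop_irrelevance.
Qed.

Lemma nltW s t : nlt s t -> nle s t.
Proof.
elim: s t => T f IH [U g] [j sgj] i; exists j; apply: (IH i).
by apply: nlt_le_trans sgj; exists i; exact: nle_refl.
Qed.

Lemma olt_of s t : olt (ord_of s) (ord_of t) <-> nlt s t.
Proof.
split=> [[/ole_of st ne]|st].
  have [/ole_of ts|//] := nle_or_lt t s.
  by case: ne; apply: ole_anti ts; exact/ole_of.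
split; first exact/ole_of/nltW.
move=> E; apply: (@nltnn s); apply: nlt_le_trans st _.
by apply/ole_of; rewrite E.
Qed.

Lemma ole_or_lt a b : ole a b \/ olt b a.
Proof.
have [s ->] := ord_ofP a; have [t ->] := ord_ofP b.
by have [?|?] := nle_or_lt s t; [left; apply/ole_of|right; apply/olt_of].
Qed.

Lemma olt_wf : well_founded olt.
Proof.
move=> a; have [t ->] := ord_ofP a.
elim: (nlt_wf t) => {a}t _ IH; constructor=> b.
by have [s ->] := ord_ofP b => /olt_of /IH.
Qed.

Lemma ole_bounded (T : Type) (f : T -> Ord) : exists b, forall i, ole (f i) b.
Proof.
pose g i := projT1 (cid (ord_ofP (f i))).
exists (ord_of (Node g)) => i.
have -> : f i = ord_of (g i) := projT2 (cid (ord_ofP (f i))).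
by apply/ole_of/nltW; exists i; exact: nle_refl.
Qed.

Lemma olt_unbounded a : exists b, olt a b.
Proof.
have [t ->] := ord_ofP a; exists (ord_of (Node (fun _ : unit => t))).
by apply/olt_of; exists tt; exact: nle_refl.
Qed.

Lemma omin_subproof (P : Ord -> Prop) : (exists a, P a) ->
  exists a, P a /\ forall b, P b -> ole a b.
Proof.
move=> [a Pa]; apply: contrapT => H.
elim: (olt_wf a) Pa => {}a _ IH Pa; apply: H; exists a.
by split=> // b Pb; have [//|/IH/(_ Pb)] := ole_or_lt a b.
Qed.

Definition omin (P : Ord -> Prop) (h : exists a, P a) : Ord :=
  projT1 (cid (omin_subproof h)).

Lemma ominP (P : Ord -> Prop) (h : exists a, P a) : P (omin h).
Proof. by rewrite /omin; case: cid => a []. Qed.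

Lemma omin_le (P : Ord -> Prop) (h : exists a, P a) b : P b -> ole (omin h) b.
Proof. by rewrite /omin; case: cid => a [_ +] Pb /=; exact. Qed.

Definition ozero : Ord := ord_of (Node (False_rect onote)).
Definition osucc (a : Ord) : Ord := omin (olt_unbounded a).
Definition is_limit (a : Ord) : Prop :=
  a <> ozero /\ ~ exists b, a = osucc b.
Definition osup (T : Type) (f : T -> Ord) : Ord := omin (ole_bounded f).

Lemma ozero_le a : ole ozero a.
Proof. by have [[T f] ->] := ord_ofP a; apply/ole_of; case. Qed.

Lemma olt_succ a : olt a (osucc a).
Proof. exact: ominP (olt_unbounded a). Qed.

Lemma osucc_le a b : olt a b -> ole (osucc a) b.
Proof. exact: omin_le. Qed.

Lemma olt_neqle a b : ole a b -> a = b \/ olt a b.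
Proof. by move=> ab; have [?|?] := pselect (a = b); [left|right]. Qed.

Lemma olt_le_false a b : olt a b -> ole b a -> False.
Proof. by move=> [ab ne] ba; apply: ne; exact: ole_anti. Qed.

Lemma olt_succ_le a b : olt a (osucc b) -> ole a b.
Proof.
move=> ab; have [//|/osucc_le ba] := ole_or_lt a b.
by case: (olt_le_false ab ba).
Qed.

Lemma osucc_inj : injective osucc.
Proof.
move=> a b E; apply: ole_anti; apply: olt_succ_le.
  by rewrite -E; exact: olt_succ.
by rewrite E; exact: olt_succ.
Qed.

Lemma osucc_neq0 a : osucc a <> ozero.
Proof.
by move=> E; apply: (olt_le_false (olt_succ a)); rewrite E; exact: ozero_le.
Qed.

Lemma ord_cases a : [\/ a = ozero, exists b, a = osucc b | is_limit a].
Proof.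
have [->|a0] := pselect (a = ozero); first exact: Or31.
by have [|aS] := pselect (exists b, a = osucc b); [exact: Or32|exact: Or33].
Qed.

(* Ordinals extended with the value [XInfty], larger than every ordinal. *)
Inductive xOrd : Type := XOrd of Ord | XInfty.

Definition xle (a b : xOrd) : Prop :=
  match a, b with
  | _, XInfty => True
  | XInfty, XOrd _ => False
  | XOrd a, XOrd b => ole a b
  end.

Definition xmax (a b : xOrd) : xOrd := if pselect (xle a b) then b else a.

Definition xsup (T : Type) (f : T -> xOrd) : xOrd :=
  if pselect (exists i, f i = XInfty) then XInfty
  else XOrd (osup (fun i => if f i is XOrd a then a else ozero)).

Lemma xsup_ub (T : Type) (f : T -> xOrd) i : xle (f i) (xsup f).
Proof.
rewrite /xsup; case: pselect => /= [_|nI]; first by case: (f i).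
have := ominP (ole_bounded (fun i => if f i is XOrd a then a else ozero)) i.
by case E: (f i) => [a|] //; case: nI; exists i.
Qed.

Lemma xsup_le (T : Type) (f : T -> xOrd) b :
  (forall i, xle (f i) b) -> xle (xsup f) b.
Proof.
move=> fb; rewrite /xsup; case: pselect => /= [[i fi]|_].
  by have := fb i; rewrite fi; case: b {fb}.
case: b fb => [b|//] fb; apply: omin_le => i; have := fb i.
by case: (f i) => // _; exact: ozero_le.
Qed.

Section TransfiniteIteration.
Variables (T : Type) (s : set T -> set T) (K : set T).

Definition titer_step (a : Ord) (rec : forall b, olt b a -> set T) : set T :=
  [set x | [\/ a = ozero /\ K x,
               exists b (ba : olt b a), a = osucc b /\ s (rec b ba) x
             | is_limit a /\ forall b (ba : olt b a), rec b ba x]].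

Definition titer : Ord -> set T := Fix olt_wf (fun=> set T) titer_step.

Lemma titerE a : titer a = titer_step (fun b (_ : olt b a) => titer b).
Proof.
rewrite /titer Fix_eq// => {}a f g fg; congr titer_step.
by apply/functional_extensionality_dep => b; apply/funext => ba; exact: fg.
Qed.

Lemma titer0 : titer ozero = K.
Proof.
rewrite titerE; apply/seteqP; split=> x /= => [|Kx]; last by apply: Or31.
by case=> [[]//|[b [_ [/esym/osucc_neq0]]]//|[[]]].
Qed.

Lemma titerS a : titer (osucc a) = s (titer a).
Proof.
rewrite titerE; apply/seteqP; split=> x /= => [|sx]; last first.
  by apply: Or32; exists a, (olt_succ a).
case=> [[/osucc_neq0]//|[b [_ [/osucc_inj ->]]]//|[[_ []]]]; by exists a.
Qed.

Lemma titer_limit a : is_limit a ->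
  titer a = [set x | forall b, olt b a -> titer b x].
Proof.
move=> la; rewrite [LHS]titerE; apply/seteqP; split=> x /= => [|ax].
  by case: la => a0 aS; case=> [[]//|[b [_ [aE _]]]|[_]//]; case: aS; exists b.
by apply: Or33.
Qed.

Hypothesis s_sub : forall A, s A `<=` A.

Lemma titer_anti a b : ole a b -> titer b `<=` titer a.
Proof.
elim: (olt_wf b) a => {}b _ IH a /olt_neqle[->//|ab].
have [b0|[c bE]|lb] := ord_cases b.
- by case: (olt_le_false ab); rewrite b0; exact: ozero_le.
- rewrite bE titerS in IH ab *; apply: subset_trans (@s_sub _) _.
  by apply: IH; [exact: olt_succ|exact: olt_succ_le].
- by rewrite (titer_limit lb) => x; exact.
Qed.

Lemma titer_stationary : exists a, forall b, ole a b -> titer b = titer a.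
Proof.
pose f x := match pselect (exists b, ~ titer b x) with
  | left h => omin h | right _ => ozero end.
have [a fa] := ole_bounded f; exists a => b ab.
apply/seteqP; split; first exact: titer_anti.
move=> x ax; apply: contrapT => nbx; have := fa x; rewrite /f.
case: pselect => /= [h /titer_anti/(_ x ax)|[]]; last by exists b.
exact: ominP h.
Qed.

End TransfiniteIteration.

Inductive scalar_kind : Type := RealScalars | ComplexScalars.

Definition scalars (R : realType) (k : scalar_kind) : numFieldType :=
  match k with RealScalars => R | ComplexScalars => R[i] end.

(* Norms in MathComp-Analysis take their values in the scalar field; [toR] and
   [ofR] convert norms between the scalar field and the real numbers. *)
Definition toR (R : realType) (k : scalar_kind) : scalars R k -> R :=
  match k with RealScalars => id | ComplexScalars => @complex.Re R end.

Definition ofR (R : realType) (k : scalar_kind) : R -> scalars R k :=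
  match k with RealScalars => id | ComplexScalars => fun x => x%:C%C end.

Section ScalarTheory.
Variables (R : realType) (k : scalar_kind).
Local Notation K := (scalars R k).
Implicit Types (x y : R) (z w : K).

Lemma ofRK x : toR (ofR k x) = x. Proof. by case: k. Qed.

Lemma toRK z : 0 <= z -> ofR k (toR z) = z.
Proof. by case: k z => //= -[a b]; rewrite lecE /= => /andP[/eqP->]. Qed.

Lemma ofR_le x y : (ofR k x <= ofR k y) = (x <= y).
Proof. by case: k => //=; rewrite lecR. Qed.

Lemma ofRD x y : ofR k (x + y) = ofR k x + ofR k y.
Proof. by case: k => //=; rewrite rmorphD. Qed.

Lemma ofRM x y : ofR k (x * y) = ofR k x * ofR k y.
Proof. by case: k => //=; rewrite rmorphM. Qed.

Lemma ofR0 : ofR k (0 : R) = 0. Proof. by case: k. Qed.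

Lemma toR_le z w : 0 <= z -> z <= w -> toR z <= toR w.
Proof.
by move=> z0 zw; rewrite -ofR_le !toRK// (le_trans z0).
Qed.

End ScalarTheory.

Definition bounded_op_pred (K : numFieldType) (X Y : normedModType K) :
  {pred X -> Y} := fun f => `[< linear f /\ continuous f >].
Arguments bounded_op_pred {K} X Y.

Lemma bounded_op_submod_closed (K : numFieldType) (X Y : normedModType K) :
  submod_closed (bounded_op_pred X Y).
Proof.
split; first by apply/asboolP; split; [move=> a u v; rewrite scaler0 addr0|exact: cst_continuous].
move=> a f g /asboolP[lf cf] /asboolP[lg cg]; apply/asboolP; split.
  move=> b u v; rewrite !fctE lf lg !scalerDr !scalerA [a * b]mulrC.
  by rewrite addrACA.
by move=> x; apply: cvgD; [apply: cvgZl_tmp; exact: cf|exact: cg].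
Qed.

HB.instance Definition _ (K : numFieldType) (X Y : normedModType K) :=
  GRing.isSubmodClosed.Build K (X -> Y) (bounded_op_pred X Y)
    (bounded_op_submod_closed X Y).

Record bounded_op (K : numFieldType) (X Y : normedModType K) := BoundedOp {
  bounded_op_fun :> X -> Y;
  bounded_opP : bounded_op_fun \in bounded_op_pred X Y }.

HB.instance Definition _ (K : numFieldType) (X Y : normedModType K) :=
  [isSub for @bounded_op_fun K X Y].
HB.instance Definition _ (K : numFieldType) (X Y : normedModType K) :=
  [Choice of bounded_op X Y by <:].
HB.instance Definition _ (K : numFieldType) (X Y : normedModType K) :=
  [SubChoice_isSubLmodule of bounded_op X Y by <:].

HB.instance Definition _ (K : numFieldType) (X Y : normedModType K)
    (f : bounded_op X Y) :=
  GRing.isLinear.Build K X Y *:%R f (asboolW (bounded_opP f)).1.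

Lemma bounded_op_continuous (K : numFieldType) (X Y : normedModType K)
  (f : bounded_op X Y) : continuous f.
Proof. exact: (asboolW (bounded_opP f)).2. Qed.

Lemma bounded_op_eq (K : numFieldType) (X Y : normedModType K)
  (f g : bounded_op X Y) : f =1 g -> f = g.
Proof. by move=> fg; apply/val_inj/funext. Qed.

Section OperatorNorm.
Variables (R : realType) (k : scalar_kind).
Local Notation K := (scalars R k).
Variables (X Y : normedModType K).
Implicit Types f g : bounded_op X Y.

Definition opnorm f : R := sup [set toR `|f x| | x in [set x | `|x| <= 1]].

Lemma opnorm_has_sup f : has_sup [set toR `|f x| | x in [set x | `|x| <= 1]].
Proof.
split; first by exists (toR `|f 0|), 0 => //=; rewrite normr0.
have /linear_boundedP : bounded_near f (nbhs (0 : X)).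
  by apply: continuous_linear_bounded; exact: bounded_op_continuous.
move=> /pinfty_ex_gt0[r r0 fr]; exists (toR r) => _ [x /= x1 <-].
by rewrite toR_le// (le_trans (fr x))// ler_piMr// ltW.
Qed.

Lemma opnorm_ub f x : `|x| <= 1 -> toR `|f x| <= opnorm f.
Proof. by move=> x1; apply: sup_upper_bound (opnorm_has_sup f) _ _; exists x. Qed.

Lemma opnorm_le f M : (forall x, `|x| <= 1 -> toR `|f x| <= M) -> opnorm f <= M.
Proof.
by move=> fM; apply: ge_sup => [|_ [x x1 <-]]; [case: (opnorm_has_sup f)|exact: fM].
Qed.

Lemma opnorm_ge0 f : 0 <= opnorm f.
Proof.
apply: le_trans (@opnorm_ub f 0 _); last by rewrite normr0.
by rewrite -(ofR_le k) ofR0 toRK.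
Qed.

Lemma opnormP f x : `|f x| <= ofR k (opnorm f) * `|x|.
Proof.
have [->|x0] := eqVneq x 0; first by rewrite raddf0 !normr0 mulr0.
have n0 : 0 < `|x| by rewrite normr_gt0.
rewrite -ler_pdivrMr// -[leLHS]mulr1.
have := @opnorm_ub f (`|x|^-1 *: x).
rewrite linearZ !normrZ normfV normr_id mulVf ?gt_eqF// => /(_ (lexx _)).
rewrite -(ofR_le k) toRK; last by rewrite mulr_ge0// invr_ge0.
by rewrite mulr1 mulrC.
Qed.

Lemma opnormD f g : ofR k (opnorm (f + g)) <= ofR k (opnorm f) + ofR k (opnorm g).
Proof.
rewrite -ofRD ofR_le; apply: opnorm_le => x x1.
rewrite -(ofR_le k) toRK// ofRD (le_trans (ler_normD _ _))// lerD//.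
  by rewrite -(toRK (normr_ge0 (f x))) ofR_le opnorm_ub.
by rewrite -(toRK (normr_ge0 (g x))) ofR_le opnorm_ub.
Qed.

Lemma opnorm_bound f M : 0 <= M -> (forall x, `|f x| <= M * `|x|) ->
  ofR k (opnorm f) <= M.
Proof.
move=> M0 fM; rewrite -(toRK M0) ofR_le; apply: opnorm_le => x x1.
by rewrite toR_le// (le_trans (fM x))// ler_piMr.
Qed.

Lemma opnormZ a f : ofR k (opnorm (a *: f)) = `|a| * ofR k (opnorm f).
Proof.
have H b g : ofR k (opnorm (b *: g)) <= `|b| * ofR k (opnorm g).
  apply: opnorm_bound => [|x]; first by rewrite mulr_ge0// -(ofR0 R k) ofR_le opnorm_ge0.
  by rewrite normrZ -mulrA ler_wpM2l// opnormP.
apply/eqP; rewrite eq_le H/=; have [->|a0] := eqVneq a 0.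
  by rewrite normr0 mul0r -(ofR0 R k) ofR_le opnorm_ge0.
have := H a^-1 (a *: f); rewrite scalerA mulVf// scale1r normfV.
by rewrite ler_pdivlMl// normr_gt0.
Qed.

Lemma opnorm0_eq0 f : ofR k (opnorm f) = 0 -> f = 0.
Proof.
move=> f0; apply: bounded_op_eq => x; apply/eqP.
by rewrite -normr_le0 (le_trans (opnormP f x))// f0 mul0r.
Qed.

HB.instance Definition _ :=
  Lmodule_isNormed.Build K (bounded_op X Y) opnormD opnormZ opnorm0_eq0.

Lemma normE f : `|f| = ofR k (opnorm f). Proof. by []. Qed.

End OperatorNorm.

Section Szlenk.
Variables (R : realType) (k : scalar_kind).
Local Notation K := (scalars R k).
Implicit Types X Y : normedModType K.

Definition dual X := bounded_op X K^o.
HB.instance Definition _ X := NormedModule.on (dual X).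

Definition dual_ball X : set (dual X) := [set f | `|f| <= 1].

(* The type of functionals with the topology of pointwise convergence. *)
Definition weak_star X : Type :=
  initial_topology (fun f : dual X => (f : {ptws X -> K^o})).
HB.instance Definition _ X := Topological.on (weak_star X).

Definition diam X (A : set X) : \bar R :=
  ereal_sup [set (toR `|x - y|)%:E | x in A & y in A].

Definition szlenk_derivation X (e : R) (A : set (dual X)) : set (dual X) :=
  [set f | A f /\ forall V : set (weak_star X),
     nbhs (f : weak_star X) V -> (e%:E < diam (V `&` A))%E].

Definition Sz_eps X (e : R) (A : set (dual X)) : xOrd :=
  match pselect (exists a, titer (szlenk_derivation e) A a = set0) with
  | left h => XOrd (omin h)
  | right _ => XInfty
  end.

Definition Sz X (A : set (dual X)) : xOrd :=
  xsup (fun e : {posnum R} => Sz_eps e%:num A).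

End Szlenk.

Arguments dual_ball {R k} X.

Section Operators.
Variables (R : realType) (k : scalar_kind).
Local Notation K := (scalars R k).

Lemma szlenk_derivation_sub (X : normedModType K) (e : R) (A : set (dual X)) :
  szlenk_derivation e A `<=` A.
Proof. by move=> f []. Qed.

(* The index types of [onote] live in a universe above that of the dual space,
   so a derivation that never becomes stationary cannot exist, and the value
   [XInfty] of [Sz_eps] means what it does when all ordinals are considered. *)
Lemma szlenk_stationary (X : normedModType K) (e : R) (A : set (dual X)) :
  exists a, forall b, ole a b ->
    titer (szlenk_derivation e) A b = titer (szlenk_derivation e) A a.
Proof. by apply: titer_stationary => B; exact: szlenk_derivation_sub. Qed.

Lemma open_weak_starE (X : normedModType K) (U : set (weak_star X)) :
  open U = exists2 A : set {ptws X -> K^o},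
    open A & (fun f : dual X => (f : {ptws X -> K^o})) @^-1` A = U.
Proof. by []. Qed.

Lemma bounded_op_compP (X Y Z : normedModType K) (g : bounded_op Y Z)
  (f : bounded_op X Y) : g \o f \in bounded_op_pred X Z.
Proof.
apply/asboolP; split=> [a u v|x]; first by rewrite /= !linearP.
by apply: continuous_comp; exact: bounded_op_continuous.
Qed.

Definition bounded_op_comp (X Y Z : normedModType K) (g : bounded_op Y Z)
  (f : bounded_op X Y) : bounded_op X Z := BoundedOp (bounded_op_compP g f).

Lemma bounded_op_le (X Y : normedModType K) (f : bounded_op X Y) x :
  `|f x| <= `|f| * `|x|.
Proof. exact: opnormP. Qed.

Lemma bounded_op_norm_le (X Y : normedModType K) (f : bounded_op X Y) M :
  0 <= M -> (forall x, `|f x| <= M * `|x|) -> `|f| <= M.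
Proof. exact: opnorm_bound. Qed.

Lemma bounded_op_comp_norm (X Y Z : normedModType K) (g : bounded_op Y Z)
  (f : bounded_op X Y) : `|bounded_op_comp g f| <= `|g| * `|f|.
Proof.
apply: bounded_op_norm_le => [|x]; first by rewrite mulr_ge0.
rewrite -mulrA (le_trans (bounded_op_le g (f x)))// ler_wpM2l//.
exact: bounded_op_le.
Qed.

Lemma bounded_linear_op (X Y : normedModType K) (f : X -> Y) (M : K) :
  0 <= M -> linear f -> (forall x, `|f x| <= M * `|x|) ->
  f \in bounded_op_pred X Y.
Proof.
move=> M0 lf fM; apply/asboolP; split=> //.
pose g : {linear X -> Y} := HB.pack f (GRing.isLinear.Build K X Y *:%R f lf).
apply: (@bounded_linear_continuous _ _ _ g); apply/linear_boundedP.
exists M; split=> [|r Mr x]; first exact: ger0_real.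
by rewrite (le_trans (fM x))// ler_wpM2r// ltW.
Qed.

Lemma adjointP (X Y : normedModType K) (A : bounded_op X Y) :
  (fun f : dual Y => bounded_op_comp f A : dual X)
    \in bounded_op_pred (dual Y) (dual X).
Proof.
apply: (@bounded_linear_op _ _ _ `|A|) => // [a f g|f].
  exact: bounded_op_eq.
by rewrite mulrC; exact: bounded_op_comp_norm.
Qed.

Definition adjoint (X Y : normedModType K) (A : bounded_op X Y) :
  bounded_op (dual Y) (dual X) := BoundedOp (adjointP A).

Definition Sz_op (X Y : normedModType K) (A : bounded_op X Y) : xOrd :=
  Sz (adjoint A @` dual_ball Y).

Definition Sz_space (X : normedModType K) : xOrd := Sz (dual_ball X).

Lemma elementary_tensorP (X Y : normedModType K) (x : X) (y : Y) :
  (fun f : dual Y => f y *: x) \in bounded_op_pred (dual Y) X.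
Proof.
apply: (@bounded_linear_op _ _ _ (`|y| * `|x|)) => [|a f g|f].
- by rewrite mulr_ge0.
- by rewrite scalerDl scalerA.
- by rewrite normrZ mulrAC ler_wpM2r// mulrC bounded_op_le.
Qed.

Definition elementary_tensor (X Y : normedModType K) (x : X) (y : Y) :
  bounded_op (dual Y) X := BoundedOp (elementary_tensorP x y).

Definition algebraic_tensors (X Y : normedModType K) :
    set (bounded_op (dual Y) X) :=
  [set u | exists n (x : 'I_n -> X) (y : 'I_n -> Y),
     u = \sum_(i < n) elementary_tensor (x i) (y i)].

Arguments algebraic_tensors : clear implicits.

Lemma algebraic_tensors_submod (X Y : normedModType K) a u v :
  algebraic_tensors X Y u -> algebraic_tensors X Y v ->
  algebraic_tensors X Y (a *: u + v).
Proof.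
move=> [n [x [y ->]]] [m [x' [y' ->]]]; exists (n + m)%N.
exists (fun i : 'I_(n + m) => match fintype.split i with inl j => a *: x j | inr j => x' j end).
exists (fun i : 'I_(n + m) => match fintype.split i with inl j => y j | inr j => y' j end).
rewrite big_split_ord/= scaler_sumr; congr (_ + _); apply: eq_bigr => i _.
  have -> := unsplitK (inl i : 'I_n + 'I_m).
  by apply: bounded_op_eq => f /=; rewrite scalerA mulrC -scalerA.
by have -> := unsplitK (inr i : 'I_n + 'I_m).
Qed.

Lemma algebraic_tensors0 (X Y : normedModType K) : algebraic_tensors X Y 0.
Proof. by exists 0, (fun=> 0), (fun=> 0); rewrite big_ord0. Qed.

Lemma closure_submod (E : normedModType K) (S : set E) a u v :
  (forall p q, S p -> S q -> S (a *: p + q)) ->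
  closure S u -> closure S v -> closure S (a *: u + v).
Proof.
move=> aS Su Sv B.
have /[apply] : (fun p : E * E => a *: p.1 + p.2) @ (u, v) --> a *: u + v.
  by apply: cvgD; [apply: cvgZl_tmp; exact: cvg_fst|exact: cvg_snd].
move=> [[P Q] /= [uP vQ] PQ]; have [p [Sp Pp]] := Su _ uP.
have [q [Sq Qq]] := Sv _ vQ; exists (a *: p + q); split; first exact: aS.
exact: (PQ (p, q)).
Qed.

Definition injective_tensor_pred (X Y : normedModType K) :
    {pred bounded_op (dual Y) X} :=
  fun u => `[< closure (algebraic_tensors X Y) u >].

Arguments injective_tensor_pred : clear implicits.

Lemma injective_tensor_submod_closed (X Y : normedModType K) :
  submod_closed (injective_tensor_pred X Y).
Proof.
split; first by apply/asboolP/subset_closure/algebraic_tensors0.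
move=> a u v /asboolP ut /asboolP vt; apply/asboolP; apply: closure_submod => //.
by move=> p q; exact: algebraic_tensors_submod.
Qed.

HB.instance Definition _ (X Y : normedModType K) :=
  GRing.isSubmodClosed.Build K (bounded_op (dual Y) X)
    (injective_tensor_pred X Y) (injective_tensor_submod_closed X Y).

Record injective_tensor (X Y : normedModType K) := InjectiveTensor {
  injective_tensor_val :> bounded_op (dual Y) X;
  injective_tensorP : injective_tensor_val \in injective_tensor_pred X Y }.

HB.instance Definition _ (X Y : normedModType K) :=
  [isSub for @injective_tensor_val X Y].
HB.instance Definition _ (X Y : normedModType K) :=
  [Choice of injective_tensor X Y by <:].
HB.instance Definition _ (X Y : normedModType K) :=
  [SubChoice_isSubLmodule of injective_tensor X Y by <:].

Section InjectiveNorm.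
Variables X Y : normedModType K.
Implicit Types u v : injective_tensor X Y.

Let injnorm u : K := `|injective_tensor_val u|.

Let injnormD u v : injnorm (u + v) <= injnorm u + injnorm v.
Proof. exact: ler_normD. Qed.

Let injnormZ a u : injnorm (a *: u) = `|a| * injnorm u.
Proof. exact: normrZ. Qed.

Let injnorm0_eq0 u : injnorm u = 0 -> u = 0.
Proof. by move/normr0_eq0 => u0; exact: val_inj. Qed.

HB.instance Definition _ := Lmodule_isNormed.Build K (injective_tensor X Y)
  injnormD injnormZ injnorm0_eq0.

Lemma injective_tensor_normE u : `|u| = `|injective_tensor_val u|.
Proof. by []. Qed.

End InjectiveNorm.

Lemma tensorP (X Y : normedModType K) (x : X) (y : Y) :
  elementary_tensor x y \in injective_tensor_pred X Y.
Proof.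
apply/asboolP/subset_closure.
by exists 1, (fun=> x), (fun=> y); rewrite big_ord1.
Qed.

Definition tensor (X Y : normedModType K) (x : X) (y : Y) :
  injective_tensor X Y := InjectiveTensor (tensorP x y).

Lemma tensor_sum_val (X Y : normedModType K) n (x : 'I_n -> X) (y : 'I_n -> Y) :
  injective_tensor_val (\sum_(i < n) tensor (x i) (y i)) =
  \sum_(i < n) elementary_tensor (x i) (y i).
Proof. exact: (big_morph (@injective_tensor_val X Y)). Qed.

Section TensorOp.
Variables (X X1 Y Y1 : normedModType K).
Variables (A : bounded_op X X1) (B : bounded_op Y Y1).

Definition extends_tensor
    (T : bounded_op (injective_tensor X Y) (injective_tensor X1 Y1)) : Prop :=
  forall n (x : 'I_n -> X) (y : 'I_n -> Y),
    T (\sum_(i < n) tensor (x i) (y i)) = \sum_(i < n) tensor (A (x i)) (B (y i)).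

Let phi (u : bounded_op (dual Y) X) : bounded_op (dual Y1) X1 :=
  bounded_op_comp A (bounded_op_comp u (adjoint B)).

Let phiP : phi \in bounded_op_pred _ _.
Proof.
apply: (@bounded_linear_op _ _ _ (`|A| * `|adjoint B|)) => [|a u v|u].
- by rewrite mulr_ge0.
- by apply: bounded_op_eq => f; rewrite /= linearP.
- rewrite -mulrA (le_trans (bounded_op_comp_norm _ _))// ler_wpM2l//.
  by rewrite [leRHS]mulrC bounded_op_comp_norm.
Qed.

Let phi_sum n (x : 'I_n -> X) (y : 'I_n -> Y) :
  phi (\sum_(i < n) elementary_tensor (x i) (y i)) =
  \sum_(i < n) elementary_tensor (A (x i)) (B (y i)).
Proof.
have /= -> := @raddf_sum _ _ (BoundedOp phiP); apply: eq_bigr => i _.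
by apply: bounded_op_eq => f; rewrite /= linearZ.
Qed.

Let phi_tensor (u : injective_tensor X Y) :
  phi u \in injective_tensor_pred X1 Y1.
Proof.
apply/asboolP => V Vu.
have uV := @bounded_op_continuous _ _ _ (BoundedOp phiP) _ _ Vu.
have /asboolP/(_ _ uV)[_ [[n [x [y ->]]] /=]] := injective_tensorP u.
by rewrite phi_sum => ?; eexists; split; [exists n; do 2!eexists|eassumption].
Qed.

Lemma tensor_op_exists : exists T, extends_tensor T.
Proof.
pose T u := InjectiveTensor (phi_tensor u).
have TP : T \in bounded_op_pred _ _.
  apply: (@bounded_linear_op _ _ _ `|BoundedOp phiP|) => [//|a u v|u].
    by apply: val_inj; exact: (linearP (BoundedOp phiP)).
  by rewrite !injective_tensor_normE; exact: bounded_op_le (BoundedOp phiP) _.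
exists (BoundedOp TP) => n x y; apply: val_inj.
by rewrite /= !tensor_sum_val phi_sum.
Qed.

Lemma tensor_op_unique S T : extends_tensor S -> extends_tensor T -> S = T.
Proof.
move=> hS hT; apply: bounded_op_eq => u; apply/eqP; rewrite -subr_eq0.
rewrite -normr_le0; apply/ler_addgt0Pr => e e0; rewrite add0r.
pose d := e / (`|S - T| + 1).
have d0 : 0 < d by rewrite divr_gt0// ltr_wpDl.
have /asboolP/(_ (ball (injective_tensor_val u) d)) := injective_tensorP u.
case; first exact: nbhsx_ballx.
move=> _ [[n [x [y ->]]]]; rewrite -ball_normE /ball_/= => uxy.
pose w := \sum_(i < n) tensor (x i) (y i).
have STw : (S - T) w = 0 by apply/eqP; rewrite [_ w]/(S w - T w) subr_eq0 hS hT.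
have -> : S u - T u = (S - T) (u - w).
  by rewrite -[LHS]/((S - T) u) -[LHS]subr0 -[in LHS]STw -linearB.
rewrite (le_trans (bounded_op_le _ _))// (@le_trans _ _ (`|S - T| * d))//.
  by rewrite ler_wpM2l// ltW// injective_tensor_normE /= tensor_sum_val.
by rewrite /d mulrCA ger_pMr// ler_pdivrMr ?mul1r ?lerDl// ltr_wpDl.
Qed.

Definition tensor_op :
    bounded_op (injective_tensor X Y) (injective_tensor X1 Y1) :=
  projT1 (cid tensor_op_exists).

Lemma tensor_opP : extends_tensor tensor_op.
Proof. exact: projT2 (cid tensor_op_exists). Qed.

End TensorOp.

End Operators.

Arguments algebraic_tensors {R k} X Y.
Arguments injective_tensor_pred {R k} X Y.

(* Main.v *)
Require Import Defs.
From mathcomp Require Import all_boot all_order all_algebra.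
From mathcomp Require Import complex.
From mathcomp Require Import all_classical all_reals all_analysis.
From mathcomp Require Import ring lra.

Set Implicit Arguments.
Unset Strict Implicit.
Unset Printing Implicit Defensive.
Import Order.TTheory GRing.Theory Num.Theory.
Import numFieldNormedType.Exports.
Local Open Scope classical_set_scope.
Local Open Scope ring_scope.

(* Both inequalities come down to the set [L] of functionals
   [A^* x^* (x) B^* y^*]: slices of it give [Sz A, Sz B <= Sz (A (x) B)], and by
   Hahn-Banach the weak-star closed convex hull of [L] contains the image of the
   dual ball under [(A (x) B)^*].

   Since these images are convex, the value [a] of the maximum is additively
   indecomposable.  Each derivation of a product [KA * KB] is charged to one of
   the factors, so a derivation of order [a] of [L] is empty, at every scale.
   It remains to pass from [L] to its hull [C].  For a weight [w] on [L], let
   [w^ f] be the upper envelope at [f] of the averages of [w] over the convex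
   combinations of points of [L] that represent functions near [f].  Let
   [l1] and [l2] be the sums of the indicators of the successive derived sets
   of order [i * b] of [L], for [i < m] and for [1 <= i <= m].  If the gap between
   [l1^ f] and [l2^ f] exceeds [1 - t], then almost all the mass of any
   combination near [f] with almost extremal [l1]-average lies on finitely many
   cells of small diameter, so that the points of [C] near [f] where [l1^] has not
   dropped are close to [f] in norm.  Hence [l1^] drops along [b] derivations of
   [C], by induction on indecomposable [b], and [m] and the number of drops
   being finite, [a] derivations exhaust [C]. *)

(** * Ordinal arithmetic *)

(** A function in the hull has no canonical representing combination, so there is no map along which
    derivations could be carried back to [L]. The envelope is a number attached to the function
    alone, which is why a drop of it can be followed along derivations of the hull. Successive
    differences of indicators of nested sets are indicators of disjoint sets, so averages at the two
    ends differ by at most 1. A gap above [1 - t] therefore leaves mass at most [t] outside the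
    cells of small diameter; that mass costs at most [t * M] in distance, which ties the scales by
    [e + t * M < e' / 2]. The induction must keep the gap near 1 after intervals are refined. This
    forces a statement about finite families of sets together with an extra weight [G]. The number
    of rounds depends on that weight and on the refinement and is merely finite; indecomposability
    of [a] absorbs any finite number of rounds of length [b]. All distances are measured through
    real parts on the unit ball, so the main estimate lives in [{ptws U -> R}] for both scalar
    fields and uses no linear structure on [U]. *)

Lemma olt_trans a b c : olt a b -> olt b c -> olt a c.
Proof.
move=> ab bc; have [ca|//] := ole_or_lt c a.
by case: (olt_le_false bc); apply: ole_trans ca ab.1.
Qed.

Lemma ole_lt_trans a b c : ole a b -> olt b c -> olt a c.
Proof. by move=> /olt_neqle[->//|ab] bc; apply: olt_trans ab bc. Qed.

Lemma olt_le_trans a b c : olt a b -> ole b c -> olt a c.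
Proof. by move=> ab /olt_neqle[<-//|bc]; apply: olt_trans ab bc. Qed.

Lemma oltnn a : ~ olt a a.
Proof. by case. Qed.

Lemma ole_ext a b : (forall c, olt c a -> olt c b) -> ole a b.
Proof. by move=> H; have [//|/H/oltnn] := ole_or_lt a b. Qed.

Lemma omax_lt a b c : olt a c -> olt b c ->
  exists d, [/\ olt d c, ole a d & ole b d].
Proof.
move=> ac bc; have [ab|ba] := ole_or_lt a b; first by exists b; split.
by exists a; split=> //; exact: ba.1.
Qed.

Lemma olt_pos a b : olt a b -> olt ozero b.
Proof. by apply: ole_lt_trans; exact: ozero_le. Qed.

(** The ordinary, non-commutative ordinal sum, not the natural one: strictly below it lie the
    ordinals below [s] and those at most [s + t'] for some [t'] below [t]. *)
Fixpoint nadd (s t : onote) {struct t} : onote :=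
  match s, t with Node U g, Node T f =>
    Node (fun x : U + T => match x with inl u => g u | inr i => nadd s (f i) end)
  end.

Lemma nadd_ltP r s t : nlt r (nadd s t) <->
  nlt r s \/ exists t', nlt t' t /\ nle r (nadd s t').
Proof.
elim: t r => T f IH r; case: s IH => U g IH; split=> /=.
  move=> [[u ru|i ri]]; first by left; exists u.
  by right; exists (f i); split=> //; exists i; exact: nle_refl.
case=> [[u ru]|[t' [[i t'i] rt']]]; first by exists (inl u).
exists (inr i); have [//|lt] := nle_or_lt r (nadd (Node g) (f i)).
suff : nle (nadd (Node g) t') (nadd (Node g) (f i)).
  move=> le; case: (@nltnn r); apply: nle_lt_trans lt.
  exact: nle_trans rt' le.
have [//|lt'] := nle_or_lt (nadd (Node g) t') (nadd (Node g) (f i)).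
case: t' t'i rt' lt' => T' f' t'i rt' [[u h|j h]].
  have /(IH i) : nlt (nadd (Node g) (f i)) (nadd (Node g) (f i)).
    by apply/IH; left; exists u.
  by move/IH/nltnn.
have /nltnn [] : nlt (nadd (Node g) (f i)) (nadd (Node g) (f i)).
apply/IH; right; exists (f' j); split=> //.
by apply: nlt_le_trans t'i; exists j; exact: nle_refl.
Qed.

Definition oadd (a b : Ord) : Ord :=
  ord_of (nadd (projT1 (cid (ord_ofP a))) (projT1 (cid (ord_ofP b)))).

(** [oadd] computes on chosen notations; this description by predecessors shows that the choice is
    immaterial, and all later facts on sums rest on it. *)
Lemma oadd_ltP c a b : olt c (oadd a b) <->
  olt c a \/ exists b', olt b' b /\ ole c (oadd a b').
Proof.
have naddW s t t' : nle t t' -> nle (nadd s t) (nadd s t').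
  move=> tt'; have [//|/nadd_ltP[h|[t2 [h1 h2]]]] := nle_or_lt (nadd s t) (nadd s t').
    by case: (@nltnn (nadd s t')); apply/nadd_ltP; left.
  case: (@nltnn (nadd s t')); apply/nadd_ltP; right; exists t2; split=> //.
  exact: nlt_le_trans h1 tt'.
rewrite /oadd; case: (cid (ord_ofP a)) => s /= ->.
case: (cid (ord_ofP b)) => t /= ->; have [r ->] := ord_ofP c.
rewrite olt_of nadd_ltP olt_of; split=> -[h|]; try by left.
  move=> [t' [h1 h2]]; right; exists (ord_of t'); split; first exact/olt_of.
  case: (cid (ord_ofP (ord_of t'))) => t2 /= E; apply/ole_of.
  by apply: nle_trans h2 _; apply/naddW/ole_of; rewrite E.
move=> [b' []]; case: (cid (ord_ofP b')) => t2 /= -> /olt_of h1 /ole_of h2.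
by right; exists t2.
Qed.

Lemma ole_addl a b : ole a (oadd a b).
Proof. by apply: ole_ext => c ca; apply/oadd_ltP; left. Qed.

Lemma oadd_lt2 a b b' : olt b' b -> olt (oadd a b') (oadd a b).
Proof. by move=> h; apply/oadd_ltP; right; exists b'; split. Qed.

Lemma ole_addr a b : ole b (oadd a b).
Proof.
elim: (olt_wf b) => {}b _ IH; apply: ole_ext => c cb.
by apply/oadd_ltP; right; exists c; split=> //; exact: IH.
Qed.

Lemma ole_add2r a a' b : ole a a' -> ole (oadd a b) (oadd a' b).
Proof.
move=> aa'; elim: (olt_wf b) => {}b _ IH; apply: ole_ext => c.
move=> /oadd_ltP[ca|[b' [b'b cb']]]; apply/oadd_ltP.
  by left; apply: olt_le_trans aa'.
by right; exists b'; split=> //; apply: ole_trans cb' _; exact: IH.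
Qed.

Lemma ole_add2l a b b' : ole b b' -> ole (oadd a b) (oadd a b').
Proof.
move=> bb'; apply: ole_ext => c /oadd_ltP[ca|[d [db cd]]]; apply/oadd_ltP.
  by left.
by right; exists d; split=> //; apply: olt_le_trans bb'.
Qed.

Lemma oadd0 a : oadd a ozero = a.
Proof.
apply: ole_anti; last exact: ole_addl.
apply: ole_ext => c /oadd_ltP[//|[b [b0 _]]].
by case: (olt_le_false b0); exact: ozero_le.
Qed.

Lemma oaddA a b c : oadd a (oadd b c) = oadd (oadd a b) c.
Proof.
elim: (olt_wf c) => {}c _ IH; apply: ole_anti; apply: ole_ext => d.
  move=> /oadd_ltP[da|[e [/oadd_ltP[eb|[c' [c'c ec']]] de]]]; apply/oadd_ltP.
  - by left; apply/oadd_ltP; left.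
  - by left; apply/oadd_ltP; right; exists e.
  - right; exists c'; split=> //; rewrite -(IH _ c'c).
    by apply: (ole_trans de); apply: ole_add2l.
move=> /oadd_ltP[/oadd_ltP[da|[b' [b'b db']]]|[c' [c'c]]].
- by apply/oadd_ltP; left.
- apply/oadd_ltP; right; exists b'; split=> //.
  by apply: olt_le_trans b'b _; exact: ole_addl.
- rewrite -(IH _ c'c) => h; apply/oadd_ltP; right; exists (oadd b c').
  by split=> //; exact: oadd_lt2.
Qed.

Definition omuln (a : Ord) (n : nat) : Ord := iter n (oadd^~ a) ozero.

Lemma omulnS a n : omuln a n.+1 = oadd (omuln a n) a.
Proof. by []. Qed.

Lemma omulnD a m n : omuln a (m + n) = oadd (omuln a m) (omuln a n).
Proof.
elim: n => [|n IH]; first by rewrite addn0 oadd0.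
by rewrite addnS !omulnS IH oaddA.
Qed.

Lemma omulnM a m n : omuln (omuln a m) n = omuln a (m * n).
Proof.
elim: n => [|n IH]; first by rewrite muln0.
by rewrite mulnS addnC omulnD omulnS IH.
Qed.

Lemma ole_omuln a b n : ole a b -> ole (omuln a n) (omuln b n).
Proof.
move=> ab; elim: n => [|n IH]; first exact: ole_refl.
rewrite !omulnS; apply: (ole_trans (b := oadd (omuln b n) a)).
  exact: ole_add2r.
exact: ole_add2l.
Qed.

Lemma omuln_gt_pos a b n : olt a (omuln b n) -> olt ozero b.
Proof.
move=> abn; have [b0|//] := ole_or_lt b ozero; have E : b = ozero.
  by apply: ole_anti => //; exact: ozero_le.
case: (@oltnn ozero); apply: ole_lt_trans (ozero_le a) _.
suff <- : omuln b n = ozero by [].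
by rewrite E; elim: (n) => [//|k IHk]; rewrite omulnS oadd0.
Qed.

(** Zero qualifies vacuously, hence the companion hypothesis [olt ozero a] later on; one qualifies
    too and is the base case of the inductions. *)
Definition indecomposable (a : Ord) : Prop :=
  forall b c, olt b a -> olt c a -> olt (oadd b c) a.

Lemma indecomposable_omuln a b n : indecomposable a -> olt b a ->
  olt (omuln b n) a.
Proof.
move=> ia ba; elim: n => [|n IH]; first exact: olt_pos ba.
by rewrite omulnS; apply: ia.
Qed.

Lemma osucc_lt a b : olt a b -> osucc a = b \/ olt (osucc a) b.
Proof. by move=> /osucc_le/olt_neqle. Qed.

Lemma indecomposable_osucc a b : indecomposable a -> a <> osucc ozero ->
  olt b a -> olt (osucc b) a.
Proof.
move=> ia a1 ba; have one : olt (osucc ozero) a.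
  by have [E|//] := osucc_lt (olt_pos ba); case: a1.
apply: ole_lt_trans (ia _ _ ba one).
apply: osucc_le; rewrite -{1}(oadd0 b); apply: oadd_lt2; exact: olt_succ.
Qed.

(** A substitute for Cantor normal forms: the least [b] with a finite multiple above [c] is
    indecomposable, for if [x + y] reached [b] with [x] and [y] below it, a multiple of the larger
    one would already exceed [c]. *)
Lemma indecomposable_approx a c : indecomposable a -> a <> osucc ozero ->
  olt c a ->
  exists b n, [/\ indecomposable b, olt b a & olt c (omuln b n)].
Proof.
move=> ia a1 ca; pose P b := exists n, olt c (omuln b n).
have exP : exists b, P b.
  exists (osucc c), 1%N; rewrite omulnS.
  by apply: (olt_le_trans (olt_succ c)); exact: ole_addr.
have [n cn] := ominP exP; set b := omin exP in cn *.
have minP d m : olt d b -> ole (omuln d m) c.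
  move=> db; have [//|lt] := ole_or_lt (omuln d m) c.
  by case: (olt_le_false db); apply: omin_le; exists m.
exists b, n; split=> //.
  move=> x y xb yb; have [z [zb xz yz]] := omax_lt xb yb.
  have [bxy|//] := ole_or_lt b (oadd x y).
  have bz : ole b (omuln z 2).
    apply: (ole_trans bxy); rewrite !omulnS.
    apply: (ole_trans (b := oadd z z)); last by apply: ole_add2r; exact: ole_addr.
    by apply: (ole_trans (b := oadd z y)); [exact: ole_add2r|exact: ole_add2l].
  case: (@oltnn c); apply: olt_le_trans cn _.
  apply: (ole_trans (b := omuln (omuln z 2) n)); first exact: ole_omuln.
  by rewrite omulnM; exact: minP.
have le : ole b (osucc c).
  apply: omin_le; exists 1%N; rewrite omulnS.
  by apply: (olt_le_trans (olt_succ c)); exact: ole_addr.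
exact: ole_lt_trans le (indecomposable_osucc ia a1 ca).
Qed.

(** * Transfinite iterations of monotone derivations *)

Section TransfiniteDerivation.
Variables (T : Type) (s : set T -> set T).
Hypothesis s_sub : forall A, s A `<=` A.
Hypothesis s_mono : forall A B, A `<=` B -> s A `<=` s B.

(** Zero, successor and limit stages get one description, which spares most later inductions a case
    distinction. *)
Lemma titerP (K : set T) a x : titer s K a x <->
  K x /\ forall b, olt b a -> s (titer s K b) x.
Proof.
have sub b c := @titer_anti _ s K s_sub b c.
split=> [ax|[Kx ax]].
  split; first by rewrite -(titer0 s K); apply: sub ax; exact: ozero_le.
  move=> b ba; have : titer s K (osucc b) x by apply: sub ax; exact: osucc_le.
  by rewrite titerS.
have [->|[b ab]|la] := ord_cases a; first by rewrite titer0.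
  by rewrite ab titerS; apply: ax; rewrite ab; exact: olt_succ.
by rewrite titer_limit// => b /ax; exact: s_sub.
Qed.

Lemma titer_sub (K : set T) a : titer s K a `<=` K.
Proof. by move=> x /titerP[]. Qed.

Lemma titer_add (K : set T) a b :
  titer s K (oadd a b) = titer s (titer s K a) b.
Proof.
elim: (olt_wf b) => {}b _ IH; apply/seteqP; split=> x /titerP[Kx H]; apply/titerP.
  split=> [|c cb]; first by apply/titerP; split=> // c ca; apply: H; apply/oadd_ltP; left.
  by rewrite -IH//; apply: H; exact: oadd_lt2.
split=> [|c /oadd_ltP[ca|[b' [b'b cb']]]]; first by case/titerP: Kx.
  by case/titerP: Kx => _; exact.
have := H _ b'b; rewrite -IH//; apply: s_mono; exact: titer_anti.
Qed.

Lemma titer_omuln (K : set T) a n :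
  titer s K (omuln a n) = iter n (fun A => titer s A a) K.
Proof.
elim: n => [|n IH]; first by rewrite titer0.
by rewrite omulnS titer_add IH.
Qed.

End TransfiniteDerivation.

(** The comparison principle behind inclusions, changes of scale and passages between different
    derivations: only one step has to be checked, and only on subsets of [K]. *)
Lemma titer_map (T T' : Type) (s : set T -> set T) (s' : set T' -> set T')
    (s_sub : forall A, s A `<=` A) (s_mono : forall A B, A `<=` B -> s A `<=` s B)
    (s'_sub : forall A, s' A `<=` A)
    (s'_mono : forall A B, A `<=` B -> s' A `<=` s' B)
    (phi : T -> T') (K : set T) (K' : set T') :
  (forall x, K x -> K' (phi x)) ->
  (forall A A' x, A `<=` K -> (forall x, A x -> A' (phi x)) -> s A x -> s' A' (phi x)) ->
  forall a x, titer s K a x -> titer s' K' a (phi x).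
Proof.
move=> KK' H a; elim: (olt_wf a) => {}a _ IH x /titerP[]// Kx ax.
apply/titerP => //; split; first exact: KK'.
move=> b ba; apply: H (ax _ ba); first exact: titer_sub.
by move=> y; exact: IH.
Qed.

Lemma titer_subset (T : Type) (s : set T -> set T)
    (s_sub : forall A, s A `<=` A) (s_mono : forall A B, A `<=` B -> s A `<=` s B)
    (K K' : set T) a : K `<=` K' -> titer s K a `<=` titer s K' a.
Proof.
move=> KK' x; apply: (titer_map s_sub s_mono s_sub s_mono (phi := id)) => //.
by move=> A A' y _ AA' /s_mono; exact.
Qed.

(** * Derivations by distant accumulation points *)

Section FarDerivation.
Variables (T : topologicalType) (far : T -> T -> Prop).
Implicit Types A B K : set T.

Definition far_points A : set T :=
  [set x | A x /\ forall V, nbhs x V -> exists y, [/\ V y, A y & far x y]].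

(* Taking the closure keeps the derived sets compact; the relation [far] need
   not be closed. *)
Definition far_der A : set T := A `&` closure (far_points A).

Lemma far_der_sub A : far_der A `<=` A.
Proof. by move=> x []. Qed.

Lemma far_points_mono A B : A `<=` B -> far_points A `<=` far_points B.
Proof.
move=> AB x [Ax H]; split=> [|V /H[y [Vy Ay xy]]]; first exact: AB.
by exists y; split=> //; exact: AB.
Qed.

Lemma far_der_mono A B : A `<=` B -> far_der A `<=` far_der B.
Proof. by move=> AB; apply: setISS => //; apply/closure_subset/far_points_mono. Qed.

Lemma titer_far_closed K a :
  exists2 F, closed F & titer far_der K a = K `&` F.
Proof.
exists [set x | forall b, olt b a -> closure (far_points (titer far_der K b)) x].
  move=> x clx b ba; apply: closed_closure.
  by move=> W /clx[y [/= yH Wy]]; exists y; split=> //; exact: yH ba.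
apply/seteqP; split=> x.
  by move=> /(titerP (@far_der_sub))[Kx H]; split=> // b /H[].
move=> [Kx H]; apply/(titerP (@far_der_sub)).
elim: (olt_wf a) H => {}a _ IH H; split=> // b ba; split; last exact: H.
apply/(titerP (@far_der_sub)); apply: (IH _ ba) => c cb.
by apply: H; exact: olt_trans cb ba.
Qed.

Definition closed_in P A := exists2 F, closed F & A = P `&` F.

Lemma closed_in_titer P A a : closed_in P A -> closed_in P (titer far_der A a).
Proof.
move=> [F cF ->]; have [G cG ->] := titer_far_closed (P `&` F) a.
by exists (F `&` G); [exact: closedI|rewrite setIA].
Qed.

(** A neighborhood free of far points of [A] and one free of far points of [B] intersect in one free
    of both. A point of [B] may be approached by far points of [A] alone; relative closedness then
    puts it in [A]. *)
Lemma far_der_setU P A B : closed_in P A -> closed_in P B ->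
  far_der (A `|` B) `<=` far_der A `|` far_der B.
Proof.
move=> [F cF AE] [G cG BE] x [ABx clx].
have Px : P x by move: ABx; rewrite AE BE => -[[]|[]].
have AP y : A y -> P y by rewrite AE => -[].
have BP y : B y -> P y by rewrite BE => -[].
have sub : far_points (A `|` B) `<=` far_points A `|` far_points B.
  move=> y [ABy Hy]; have Py : P y by case: ABy => [/AP|/BP].
  have aux (C H : set T) : closed H -> C = P `&` H ->
      (forall V, nbhs y V -> exists z, [/\ V z, C z & far y z]) -> far_points C y.
    move=> cH -> h; split=> //; split=> //; apply: cH => V /h[z [Vz [_ Hz] _]].
    by exists z.
  apply: contrapT => /not_orP[nA nB].
  have /existsNP[V /not_implyP[yV nV]] : ~ forall V, nbhs y V -> exists z, [/\ V z, A z & far y z].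
    by move=> /(aux _ _ cF AE).
  have /existsNP[W /not_implyP[yW nW]] : ~ forall V, nbhs y V -> exists z, [/\ V z, B z & far y z].
    by move=> /(aux _ _ cG BE).
  have [z [[Vz Wz] [Az|Bz] yz]] := Hy _ (filterI yV yW).
    by apply: nV; exists z.
  by apply: nW; exists z.
have := closure_subset sub clx; rewrite closureU => -[cl|cl]; [left|right]; split=> //.
  rewrite AE; split=> //; have /closure_id -> := cF; apply: closure_subset cl.
  by move=> y [+ _]; rewrite AE => -[].
rewrite BE; split=> //; have /closure_id -> := cG; apply: closure_subset cl.
by move=> y [+ _]; rewrite BE => -[].
Qed.

(** A point that has left both iterations did so before a common stage below [a], where the one-step
    inclusion is contradicted. *)
Lemma titer_far_setU P A B a : closed_in P A -> closed_in P B ->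
  titer far_der (A `|` B) a `<=` titer far_der A a `|` titer far_der B a.
Proof.
move=> cA cB; have tP := titerP (@far_der_sub).
have anti C b c : ole b c -> titer far_der C c `<=` titer far_der C b.
  exact: (titer_anti (@far_der_sub)).
elim: (olt_wf a) => {}a _ IH x /tP[ABx H]; apply: contrapT => /not_orP[nA nB].
have aux (C : set T) : C x -> ~ titer far_der C a x ->
    exists b, olt b a /\ ~ far_der (titer far_der C b) x.
  move=> Cx nC; apply: contrapT => /forallNP nH; apply: nC; apply/tP; split=> // b ba.
  by apply: contrapT => h; apply: (nH b).
have step b : olt b a ->
    far_der (titer far_der A b) x \/ far_der (titer far_der B b) x.
  move=> ba; apply: (@far_der_setU P); [exact: closed_in_titer|exact: closed_in_titer|].
  by apply: far_der_mono (H _ ba); exact: IH.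
have [Ax|nAx] := pselect (A x); have [Bx|nBx] := pselect (B x); last by case: ABx.
- have [b [ba nb]] := aux _ Ax nA; have [c [ca nc]] := aux _ Bx nB.
  have [d [da bd cd]] := omax_lt ba ca.
  have [h|h] := step _ da.
    by apply: nb; apply: far_der_mono h; exact: anti.
  by apply: nc; apply: far_der_mono h; exact: anti.
- have [b [ba nb]] := aux _ Ax nA; by have [//|[/(titer_sub (@far_der_sub))]] := step _ ba.
- have [b [ba nb]] := aux _ Bx nB; by have [[/(titer_sub (@far_der_sub))]|//] := step _ ba.
Qed.

End FarDerivation.

(** * Continuous images of compact sets *)

Section FarImage.
Variables (T T' : topologicalType) (far : T' -> T' -> Prop) (phi : T -> T').
Let farT x y := far (phi x) (phi y).

Lemma phi_near (P : set T) x V : {within P, continuous phi} -> P x ->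
  nbhs (phi x) V -> \forall y \near x, P y -> V (phi y).
Proof. by move=> /subspace_continuousP cphi Px; exact: cphi. Qed.

(** A far point lifts to a cluster point of the preimages of its far neighbors: this lies over it by
    the Hausdorff property, and [farT] is read through [phi]. The closure is absorbed because the
    image of the lifted derived set is compact. *)
Lemma far_der_image (P A : set T) : compact P -> closed_in P A ->
    {within P, continuous phi} -> hausdorff_space T' ->
  far_der far (phi @` A) `<=` phi @` far_der farT A.
Proof.
move=> cP [F cF AE] cphi hT y [_ cly].
have cA : compact A by rewrite AE; apply: compact_closedI.
have AP x : A x -> P x by rewrite AE => -[].
have sub : far_points far (phi @` A) `<=` phi @` far_points farT A.
  move=> z [_ Hz]; pose S V := A `&` phi @^-1` V `&` [set a | far z (phi a)].
  have FF : ProperFilter (filter_from (nbhs z) S).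
    apply: filter_from_proper.
      apply: filter_from_filter; first by exists setT; exact: filterT.
      move=> V W zV zW; exists (V `&` W); first exact: filterI.
      by move=> a [[Aa [Va Wa]] za].
    by move=> V /Hz[w [Vw [a Aa aw] zw]]; exists a; rewrite /S /= aw.
  have [x [Ax clx]] : A `&` cluster (filter_from (nbhs z) S) !=set0.
    by apply: cA; exists setT; [exact: filterT|move=> a [[]]].
  have xz : z = phi x.
    apply: hT => V W zV xW; have SV : filter_from (nbhs z) S (S V) by exists V.
    have Px : P x by exact: AP.
    have [a [[[Aa Va] _] Wa]] := clx _ _ SV (phi_near cphi Px xW).
    by exists (phi a); split=> //; apply: Wa; exact: AP.
  exists x => //; split=> // V xV.
  have ST : filter_from (nbhs z) S (S setT) by exists setT => //; exact: filterT.
  have [a [[[Aa _] za] Va]] := clx _ _ ST xV.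
  by exists a; split=> //; rewrite /farT -xz.
have cl : closed (phi @` far_der farT A).
  apply: compact_closed => //; apply: continuous_compact.
    by apply: continuous_subspaceW cphi => x [/AP].
  by apply: compact_closedI => //; exact: closed_closure.
have /closure_id -> := cl; apply: closure_subset cly.
apply: subset_trans sub _; apply: image_subset => x xA; split; first by case: xA.
exact: subset_closure.
Qed.

(** The derived sets of earlier stages meet the fiber of [y] and decrease; being relatively closed
    in a compact set, they share a point of that fiber. *)
Lemma titer_far_image (P : set T) a : compact P ->
    {within P, continuous phi} -> hausdorff_space T' ->
  titer (far_der far) (phi @` P) a `<=` phi @` titer (far_der farT) P a.
Proof.
move=> cP cphi hT; have tP := titerP (@far_der_sub T farT).
have tP' := titerP (@far_der_sub T' far).
have PP : closed_in P P by exists setT; [exact: closedT|rewrite setIT].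
elim: (olt_wf a) => {}a _ IH y /tP'[[x0 Px0 x0y] H].
pose D b := far_der farT (titer (far_der farT) P b).
have DP b : olt b a -> exists2 x, D b x & phi x = y.
  move=> ba; have := far_der_mono (IH _ ba) (H _ ba).
  by move=> /(far_der_image cP (closed_in_titer _ _ PP) cphi hT).
have cD b : closed_in P (D b).
  by rewrite /D -titerS; exact: closed_in_titer.
have [|ne] := pselect (exists b, olt b a); last first.
  exists x0 => //; apply/tP; split=> // b ba; by case: ne; exists b.
move=> [b0 b0a].
pose S b := P `&` D b `&` [set x | phi x = y].
have anti b c : ole b c -> S c `<=` S b.
  move=> bc x [[Px Dx] xy]; split=> //; split=> //; apply: far_der_mono Dx.
  exact: (titer_anti (@far_der_sub T farT) bc).
pose F : set_system T := [set W | exists b, olt b a /\ S b `<=` W].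
have FF : ProperFilter F.
  split.
    move=> [b [ba S0]]; have [x Dx xy] := DP _ ba; apply: (S0 x); split=> //.
    by split=> //; have [G _ DE] := cD b; move: Dx; rewrite DE => -[].
  split.
  - by exists b0.
  - move=> V W [b [ba bV]] [c [ca cW]]; have [d [da bd cd]] := omax_lt ba ca.
    exists d; split=> // x Sx.
    by split; [apply: bV; apply: (anti b d)|apply: cW; apply: (anti c d)].
  - by move=> V W VW [b [ba bV]]; exists b; split=> // x /bV /VW.
have FS b : olt b a -> F (S b) by move=> ba; exists b; split.
have [x [Px clx]] : P `&` cluster F !=set0.
  by apply: cP; exists b0; split=> // x [[]].
exists x.
  apply/tP; split=> // b ba; have [G cG DE] := cD b; rewrite -/(D b) DE; split=> //.
  apply: cG => V xV; have [z [[[_ +] _] Vz]] := clx _ _ (FS _ ba) xV.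
  by rewrite DE => -[_ Gz]; exists z.
apply/esym/hT => V W yV xW.
have [z [[[Pz _] /= zy] Wz]] := clx _ _ (FS _ b0a) (phi_near cphi Px xW).
exists y; split; first exact: nbhs_singleton.
by rewrite -zy; exact: Wz.
Qed.

End FarImage.

(** * Derivations of products *)

Section FarProduct.
Variables (T1 T2 : topologicalType).
Variables (far1 : T1 -> T1 -> Prop) (far2 : T2 -> T2 -> Prop).

Definition far_prod (z w : T1 * T2) := far1 z.1 w.1 \/ far2 z.2 w.2.

Lemma far_der_setX A B : far_der far_prod (A `*` B) `<=`
  (far_der far1 A `*` B) `|` (A `*` far_der far2 B).
Proof.
move=> [x y] [[/= Ax By] clz].
have : far_points far_prod (A `*` B) `<=`
    fst @^-1` far_points far1 A `|` snd @^-1` far_points far2 B.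
  move=> [u v] [[/= Au Bv] H]; apply: contrapT => /not_orP[/= n1 n2].
  have /existsNP[V /not_implyP[uV nV]] : ~ forall V, nbhs u V -> exists z, [/\ V z, A z & far1 u z].
    by move=> h; apply: n1.
  have /existsNP[W /not_implyP[vW nW]] : ~ forall V, nbhs v V -> exists z, [/\ V z, B z & far2 v z].
    by move=> h; apply: n2.
  have [|[p q] [[/= Vp Wq] [/= Ap Bq] [far|far]]] := H (V `*` W).
  - by exists (V, W).
  - by apply: nV; exists p.
  - by apply: nW; exists q.
move=> /closure_subset/(_ _ clz); rewrite closureU => -[cl|cl].
  left; split=> //; split=> // V xV.
  have [|[p q] [/= h1 h2]] := cl (fst @^-1` V); last by exists p.
  exact: cvg_fst.
right; split=> //; split=> // V xV.
have [|[p q] [/= h1 h2]] := cl (snd @^-1` V); last by exists q.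
exact: cvg_snd.
Qed.

Lemma closed_in_setX (P A : set T1) (Q B : set T2) :
  closed_in P A -> closed_in Q B -> closed_in (P `*` Q) (A `*` B).
Proof.
move=> [F cF ->] [G cG ->]; exists (F `*` G).
  apply: (@closedI _ (fst @^-1` F) (snd @^-1` G)).
    by apply: closed_comp => // z _; exact: cvg_fst.
  by apply: closed_comp => // z _; exact: cvg_snd.
by apply/seteqP; split=> -[x y] /= [[? ?] [? ?]].
Qed.

(* Each step of the product derivation charges one of the two factors. *)
Lemma titer_far_setX a A B : indecomposable a -> olt ozero a ->
  titer (far_der far_prod) (A `*` B) a `<=`
  (titer (far_der far1) A a `*` B) `|` (A `*` titer (far_der far2) B a).
Proof.
have t1 := titerP (@far_der_sub T1 far1).
have t2 := titerP (@far_der_sub T2 far2).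
have t3 := titerP (@far_der_sub _ far_prod).
have o1 := titer_omuln (@far_der_sub T1 far1) (@far_der_mono T1 far1).
have o2 := titer_omuln (@far_der_sub T2 far2) (@far_der_mono T2 far2).
have o3 := titer_omuln (@far_der_sub _ far_prod) (@far_der_mono _ far_prod).
elim: (olt_wf a) A B => {}a _ IH A B ia a0.
have [->|a1] := pselect (a = osucc ozero).
  by rewrite !titerS !titer0; exact: far_der_setX.
move=> z az; have [[Az Bz] _] := (t3 _ _ _).1 az.
apply: contrapT => /not_orP[nA nB].
have [b [ba nb]] : exists b, olt b a /\ ~ titer (far_der far1) A b z.1.
  apply: contrapT => /forallNP nH; apply: nA; split=> //; apply/t1; split=> // b ba.
  rewrite -titerS; apply: contrapT => h; apply: (nH (osucc b)); split=> //.
  exact: indecomposable_osucc.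
have [c [ca nc]] : exists c, olt c a /\ ~ titer (far_der far2) B c z.2.
  apply: contrapT => /forallNP nH; apply: nB; split=> //; apply/t2; split=> // c ca.
  rewrite -titerS; apply: contrapT => h; apply: (nH (osucc c)); split=> //.
  exact: indecomposable_osucc.
have [d [da bd cd]] := omax_lt ba ca.
have [e [n [ie ea de]]] := indecomposable_approx ia a1 da.
pose s1 A := titer (far_der far1) A e; pose s2 B := titer (far_der far2) B e.
pose s3 C := titer (far_der far_prod) C e.
have e0 : olt ozero e := omuln_gt_pos de.
(* Pigeonhole: each of the [m] blocks of length [e] is charged to one factor by the induction
   hypothesis, so either [i] blocks go to the first factor or [j] to the second. *)
have claim m : forall i j C D, (i + j <= m.+1)%N ->
    closed_in A C -> closed_in B D ->
    iter m s3 (C `*` D) z -> iter i s1 C z.1 \/ iter j s2 D z.2.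
  elim: m => [|m IHm] i j C D ijm cC cD.
    case: i ijm => [|i] ijm [Cz Dz]; first by left.
    by right; case: j ijm => [//|j]; rewrite addnS addSn.
  rewrite iterSr => h.
  have cX : closed_in (A `*` B) (s1 C `*` D).
    by apply: closed_in_setX => //; exact: closed_in_titer.
  have cY : closed_in (A `*` B) (C `*` s2 D).
    by apply: closed_in_setX => //; exact: closed_in_titer.
  have hU k : iter k s3 ((s1 C `*` D) `|` (C `*` s2 D)) `<=`
      iter k s3 (s1 C `*` D) `|` iter k s3 (C `*` s2 D).
    rewrite -!o3; exact: titer_far_setU cX cY.
  have : iter m s3 (s3 (C `*` D)) `<=` iter m s3 ((s1 C `*` D) `|` (C `*` s2 D)).
    rewrite -!o3; apply: titer_subset; [exact: far_der_sub|exact: far_der_mono|].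
    exact: IH.
  move=> /(_ _ h)/hU[{}h|{}h].
    case: i ijm => [_|i ijm]; last first.
      rewrite iterSr; apply: IHm h => //; exact: closed_in_titer.
    left; move: h; rewrite -o3 => /(titer_sub (@far_der_sub _ far_prod))[+ _].
    exact: (titer_sub (@far_der_sub _ far1)).
  case: j ijm => [_|j ijm]; last first.
    rewrite [iter j.+1 _ _]iterSr; apply: IHm h => //; last exact: closed_in_titer.
    by rewrite addnS in ijm.
  right; move: h; rewrite -o3 => /(titer_sub (@far_der_sub _ far_prod))[_ +].
  exact: (titer_sub (@far_der_sub _ far2)).
have self (T : topologicalType) (P : set T) : closed_in P P.
  by exists setT; [exact: closedT|rewrite setIT].
have := claim (n + n)%N n n A B (leqnSn _) (self _ A) (self _ B).
rewrite -o3 -o1 -o2 => -[||].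
- apply: titer_anti az; first exact: far_der_sub.
  exact: (indecomposable_omuln _ ia ea).1.
- move=> h; apply: nb; apply: titer_anti h; first exact: far_der_sub.
  exact: ole_trans bd de.1.
- move=> h; apply: nc; apply: titer_anti h; first exact: far_der_sub.
  exact: ole_trans cd de.1.
Qed.

End FarProduct.

(** * Convex combinations and the main estimate *)

Section FiniteCover.
Variable T : topologicalType.

Lemma compact_finite_cover (K : set T) (O : T -> set T) : compact K ->
  (forall q, K q -> nbhs q (O q)) ->
  exists s : seq T, (forall q, q \in s -> K q) /\
    forall x, K x -> exists2 q, q \in s & O q x.
Proof.
move=> /compact_near_coveringP cK KO.
(* Finite sequences directed by inclusion; near-covering compactness along this filter produces a
   single sequence that serves all points. *)
pose F : set_system (seq T) := [set W | exists s0 : seq T, forall s : seq T,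
  {subset s0 <= s} -> W s].
have FF : Filter F.
  split; first by exists [::].
    move=> V W [s1 h1] [s2 h2]; exists (s1 ++ s2) => s hs.
    by split; [apply: h1|apply: h2] => q qs; apply: hs; rewrite mem_cat qs ?orbT.
  by move=> V W VW [s1 h1]; exists s1 => s /h1 /VW.
have [x Kx|s0 /(_ s0 (fun _ => id)) h] :=
    cK _ F (fun s x => exists2 q, q \in s & K q /\ O q x) FF.
  exists (O x, [set s : seq T | x \in s]) => /=.
    by split; [exact: KO|exists [:: x] => s; apply; rewrite mem_head].
  by move=> [y s] /= [Oy xs]; exists x.
exists [seq q <- s0 | `[< K q >]]; split=> [q|x /h[q qs [Kq Oqx]]].
  by rewrite mem_filter => /andP[/asboolP].
by exists q => //; rewrite mem_filter qs andbT; apply/asboolP.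
Qed.

End FiniteCover.

Section PointwiseBoxes.
Variables (R : realType) (U : topologicalType).
Local Notation V := {ptws U -> R}.

Lemma nbhs_ptws_box (f : V) (s : seq U) (e : R) : 0 < e ->
  nbhs f [set g : V | forall u, u \in s -> `|g u - f u| < e].
Proof.
move=> e0; elim: s => [|u s IH].
  by apply: filterS filterT => g _ u.
have fu : nbhs f [set g : V | `|g u - f u| < e].
  have /cvgrPdist_lt/(_ e e0) : (fun g : V => g u) @ nbhs f --> f u.
    exact: (@proj_continuous U (fun=> R) u f).
  by apply: filterS => g; rewrite /= distrC.
apply: filterS (filterI fu IH) => g [gu gs] v; rewrite inE => /orP[/eqP->//|].
exact: gs.
Qed.

(** The filter generated by the boxes converges to [f] pointwise, so it refines the neighborhood
    filter. *)
Lemma nbhs_ptws_boxP (f : V) (W : set V) : nbhs f W ->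
  exists (s : seq U) (e : R), 0 < e /\
    forall g : V, (forall u, u \in s -> `|g u - f u| < e) -> W g.
Proof.
pose B (z : seq U * R) := [set g : V | forall u, u \in z.1 -> `|g u - f u| < z.2].
pose F := filter_from [set z : seq U * R | 0 < z.2] B.
have FF : Filter F.
  apply: filter_from_filter; first by exists ([::], 1) => /=.
  move=> [s e] [t d] /= e0 d0; exists (s ++ t, Num.min e d) => /=.
    by rewrite lt_min e0.
  move=> g /= h; split=> u /= us.
    by have := h u; rewrite mem_cat us lt_min => /(_ isT)/andP[].
  by have := h u; rewrite mem_cat us orbT lt_min => /(_ isT)/andP[].
have Ff : {ptws, F --> f}.
  apply/pointwise_cvgP => u; apply/cvgrPdist_lt => e e0.
  exists ([:: u], e) => //= g /= /(_ u); rewrite mem_head distrC; exact.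
move=> /Ff[[s e] /= e0 h]; exists s, e; split=> // g; exact: h.
Qed.

End PointwiseBoxes.

Section ConvexCombinations.
Variables (R : realType) (U : topologicalType).
Local Notation V := {ptws U -> R}.
Variable L : set V.
Implicit Types (s : seq (R * V)) (w : V -> R) (f : V).

(** Lists with possible repetitions: points can be moved by a map without merging those that come to
    coincide. *)
Definition combo s :=
  (forall c, c \in s -> 0 <= c.1 /\ L c.2) /\ \sum_(c <- s) c.1 = 1.

Definition bary s : V := fun u => \sum_(c <- s) c.1 * c.2 u.

Definition weight w s : R := \sum_(c <- s) c.1 * w c.2.

(* The concave upper semicontinuous envelope of [w] at [f] is at most [g]. *)
Definition below w (g : R) f := \forall x \near f,
  forall s, combo s -> bary s = x -> weight w s <= g.

Lemma weight_le w w' s : combo s -> (forall p, L p -> w p <= w' p) ->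
  weight w s <= weight w' s.
Proof.
move=> [sL _] ww'; rewrite /weight big_seq_cond [leRHS]big_seq_cond.
apply: ler_sum => c; rewrite andbT => /sL[c0 Lc].
by rewrite ler_wpM2l// ww'.
Qed.

Lemma weightD w w' s : weight (fun p => w p + w' p) s = weight w s + weight w' s.
Proof. by rewrite /weight -big_split/=; apply: eq_bigr => c _; rewrite mulrDr. Qed.

Lemma weightZ a w s : weight (fun p => a * w p) s = a * weight w s.
Proof. by rewrite /weight mulr_sumr; apply: eq_bigr => c _; rewrite mulrCA. Qed.

Lemma weight_cst a s : combo s -> weight (fun=> a) s = a.
Proof. by move=> [_ s1]; rewrite /weight -mulr_suml s1 mul1r. Qed.

Lemma weight_map w (r : V -> V) s :
  weight w [seq (c.1, r c.2) | c <- s] = weight (w \o r) s.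
Proof. by rewrite /weight big_map. Qed.

Lemma combo_map (r : V -> V) s : (forall p, L p -> L (r p)) -> combo s ->
  combo [seq (c.1, r c.2) | c <- s].
Proof.
move=> rL [sL s1]; split; last by rewrite big_map.
by move=> c /mapP[d /sL[d0 Ld] ->]; split=> //; exact: rL.
Qed.

Lemma below_near w g f : below w g f -> \forall x \near f, below w g x.
Proof. by move=> /near_join. Qed.

Lemma belowW w w' g f : (forall p, L p -> w p <= w' p) ->
  below w' g f -> below w g f.
Proof.
move=> ww'; apply: filterS => x H s cs sx.
by apply: le_trans (H _ cs sx); exact: weight_le.
Qed.

Lemma not_below w h f W : ~ below w h f -> nbhs f W ->
  exists s, [/\ combo s, W (bary s) & h < weight w s].
Proof.
move=> nb fW; apply: contrapT => /forallNP H; apply: nb.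
apply: filterS fW => x Wx s cs sx; rewrite leNgt; apply/negP => hs.
by apply: (H s); split=> //; rewrite sx.
Qed.

Lemma bary_dist (r : V -> V) s u (e : R) : combo s ->
  (forall p, L p -> `|p u - r p u| <= e) ->
  `|bary s u - bary [seq (c.1, r c.2) | c <- s] u| <= e.
Proof.
move=> cs re; rewrite /bary big_map -sumrB.
rewrite (le_trans (ler_norm_sum _ _ _))// -(weight_cst e cs) /weight.
rewrite big_seq_cond [leRHS]big_seq_cond; apply: ler_sum => c.
rewrite andbT => /(cs.1)[c0 Lc] /=; rewrite -mulrBr normrM ger0_norm//.
by rewrite ler_wpM2l// re.
Qed.

(* Moving the points of a combination to nearby points of a finite net
   compares weights that are related by semicontinuity only. *)
Lemma below_net w g f (O : V -> set V) : compact L -> below w g f ->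
  (forall q, L q -> nbhs q (O q)) ->
  exists (r : V -> V) (qs : seq V), [/\
    forall q, q \in qs -> L q,
    forall p, L p -> r p \in qs /\ O (r p) p &
    \forall x \near f, forall s, combo s -> bary s = x -> weight (w \o r) s <= g].
Proof.
move=> cL /nbhs_ptws_boxP[us [e [e0 H]]] LO.
have e20 : 0 < e / 2 by rewrite divr_gt0.
pose O' q := O q `&` [set p : V | forall u, u \in us -> `|p u - q u| < e / 2].
have [|qs [qL cov]] := @compact_finite_cover _ L O' cL.
  by move=> q Lq; apply: filterI; [exact: LO|exact: nbhs_ptws_box].
have ex p : exists q, L p -> q \in qs /\ O' q p.
  by have [/cov[q qs' Oq]|] := pselect (L p); [exists q|exists p].
pose r p := projT1 (cid (ex p)).
have rP p : L p -> r p \in qs /\ O' (r p) p by exact: projT2 (cid (ex p)).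
have rL p : L p -> L (r p) by move=> /rP[/qL].
exists r, qs; split=> // [p /rP[? []]//|].
(* Moving the points to the net displaces the barycenter by at most [e / 2] on [us], so one starting
   within [e / 2] of [f] stays in the box where [w] is controlled. *)
apply: filterS (nbhs_ptws_box f us e20) => x xf s cs sx.
rewrite -weight_map; have cs' := combo_map rL cs; apply: H (cs') _ => // u uus.
rewrite -(subrKA (x u)) (splitr e) (le_lt_trans (ler_normD _ _))//.
rewrite ler_ltD ?xf// -sx distrC; apply: bary_dist => // p Lp.
by have [_ [_ /(_ u uus)/ltW]] := rP _ Lp.
Qed.

End ConvexCombinations.

(** * Masses of combinations on the cells of a net *)

Section NetMasses.
Variables (R : realType) (U : topologicalType).
Local Notation V := {ptws U -> R}.
Variables (L : set V) (B : set U) (M : R).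
Hypothesis L_compact : compact L.
Hypothesis M_ge0 : 0 <= M.
Hypothesis L_bounded : forall p u, L p -> B u -> `|p u| <= M.

Definition far_on (e : R) (f g : V) := exists2 u, B u & e < `|f u - g u|.

Definition ind (A : set V) (p : V) : R := (`[< A p >])%:R.

Lemma ind_ge0 A p : 0 <= ind A p. Proof. exact: ler0n. Qed.

Lemma ind_le1 A p : ind A p <= 1. Proof. by rewrite lern1 leq_b1. Qed.

Lemma ind_le A A' p q : (A p -> A' q) -> ind A p <= ind A' q.
Proof.
move=> AA'; rewrite ler_nat; case: asboolP => // /AA' h.
by rewrite asboolT.
Qed.

Lemma ind_id A p : A p -> ind A p = 1. Proof. by move=> h; rewrite /ind asboolT. Qed.

(** The form that upper semicontinuity on [L] takes for weights with finitely many values; it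
    survives sums and nonnegative multiples. *)
Definition locmax (w : V -> R) := forall q, L q -> \forall p \near q, L p -> w p <= w q.

Lemma locmaxD w w' : locmax w -> locmax w' -> locmax (fun p => w p + w' p).
Proof.
move=> h h' q Lq; apply: filterS (filterI (h q Lq) (h' q Lq)) => p [wp wp'] Lp.
by rewrite lerD// ?wp// wp'.
Qed.

Lemma locmaxZ a w : 0 <= a -> locmax w -> locmax (fun p => a * w p).
Proof.
by move=> a0 h q Lq; apply: filterS (h q Lq) => p wp Lp; rewrite ler_wpM2l// wp.
Qed.

Lemma near_closed_in A q : closed_in L A -> L q ->
  \forall p \near q, L p -> A p -> A q.
Proof.
move=> [F cF ->] Lq; have [Fq|nFq] := pselect (F q).
  by apply: filterS filterT => p _ _ _; split.
have : nbhs q (~` F) by apply: open_nbhs_nbhs; split=> //; exact: closed_openC.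
by apply: filterS => p nFp Lp [_ /nFp].
Qed.

Lemma locmax_ind A : closed_in L A -> locmax (ind A).
Proof.
move=> cA q Lq; apply: filterS (near_closed_in cA Lq) => p h Lp.
by apply: ind_le; exact: h.
Qed.

Lemma locmax_sum (I : finType) (w : I -> V -> R) :
  (forall i, locmax (w i)) -> locmax (fun p => \sum_i w i p).
Proof.
move=> h q Lq; have : \forall p \near q, forall i, L p -> w i p <= w i q.
  by apply: (@filter_forall V I (fun i p => L p -> w i p <= w i q) (nbhs q) _) => i; exact: h.
by apply: filterS => p wp Lp; apply: ler_sum => i _; exact: wp.
Qed.

(* The combinations near a given function fall into finitely many classes with
   almost constant masses on each cell of a net; two functions adherent to
   the same class are close. *)
Lemma net_masses_close (r : V -> V) (qs : seq V) (good : set V) (e t e' : R)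
    (S : set V) (f : V) :
  0 <= e -> 0 <= t -> e + t * M < e' / 2 -> (forall q, q \in qs -> L q) ->
  (forall p, L p -> r p \in qs) ->
  (forall p u, L p -> good p -> B u -> `|p u - r p u| <= e) ->
  (forall f', S f' -> forall N, nbhs f' N ->
     exists s, [/\ combo L s, N (bary s) & 1 - t <= weight (ind good) s]) ->
  ~ (forall N, nbhs f N -> exists2 f', N f' /\ S f' & far_on e' f f').
Proof.
move=> e0 t0 ete qsL rqs rgood Sgood farf.
pose d := e' / 2 - (e + t * M).
have d0 : 0 < d by rewrite subr_gt0.
pose us := undup qs; pose k := size us.
pose m q s := weight (ind (good `&` [set p | r p = q])) s.
have m01 q s : combo L s -> 0 <= m q s <= 1.
  move=> cs; rewrite -(weight_cst 0 cs) -(weight_cst 1 cs).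
  by rewrite !(weight_le cs)// => p _; rewrite ?ind_ge0 ?ind_le1.
(* Masses that agree up to [1 / n] on [k] cells give values at [u] that agree up to [k * M / n],
   here at most [d / 2]. *)
pose n := (Num.truncn (2 * k%:R * M / d)).+1.
have n0 : 0 < n%:R :> R by rewrite ltr0n.
have nd : k%:R * (n%:R^-1 * M) <= d / 2.
  rewrite mulrCA ler_pdivrMl// -ler_pdivrMr ?divr_gt0//.
  rewrite invf_div mulrA ltW//; apply: le_lt_trans (truncnS_gt _).
  by rewrite [_ * M * 2]mulrC mulrA.
(* Masses rounded down to multiples of [1 / n]; ['I_n.+1] leaves room for a mass equal to 1. *)
pose ty (a : {ffun 'I_k -> 'I_n.+1}) s := forall j : 'I_k,
  (a j)%:R <= n%:R * m (nth f us j) s <= (a j)%:R + 1.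
have tyE s : combo L s -> exists a, ty a s.
  move=> cs; exists [ffun j : 'I_k => inord (Num.truncn (n%:R * m (nth f us j) s))] => j.
  have /andP[m0 m1] := m01 (nth f us j) s cs.
  have nm0 : 0 <= n%:R * m (nth f us j) s by rewrite mulr_ge0// ltW.
  rewrite ffunE inordK; last first.
    rewrite ltnS -(ler_nat R) (@le_trans _ _ (n%:R * m (nth f us j) s)) ?truncn_le//.
    by rewrite ler_piMr// ltW.
  by rewrite truncn_le nm0/= natr1 ltW// truncnS_gt.
pose adh (f' : V) (a : {ffun 'I_k -> 'I_n.+1}) := forall N, nbhs f' N ->
  exists s, [/\ combo L s, N (bary s), 1 - t <= weight (ind good) s & ty a s].
have adhE f' : S f' -> exists a, adh f' a.
  move=> Sf'; apply: contrapT => /forallNP nadh.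
  have : \forall x \near f', forall a, forall s, combo L s -> bary s = x ->
      1 - t <= weight (ind good) s -> ~ ty a s.
    apply: (@filter_forall V _ (fun a x => forall s, combo L s -> bary s = x ->
      1 - t <= weight (ind good) s -> ~ ty a s) (nbhs f') _) => a.
    have /existsNP[N /not_implyP[fN nN]] := nadh a.
    apply: filterS fN => x Nx s cs sx gs tas; apply: nN; exists s; split=> //.
    by rewrite sx.
  move=> /(Sgood _ Sf')[s [cs sN gs]]; have [a tas] := tyE s cs.
  exact: (sN a s cs erefl gs).
(* As there are finitely many types, a single one adheres to functions of [S] far from [f] inside
   every neighborhood of [f], and hence to [f] itself. *)
have [a fa] : exists a, forall N, nbhs f N ->
    exists f', [/\ N f', far_on e' f f' & adh f' a].
  apply: contrapT => /forallNP nadh.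
  have : \forall x \near f, forall a, ~ (far_on e' f x /\ adh x a).
    apply: (@filter_forall V _ (fun a x => ~ (far_on e' f x /\ adh x a)) (nbhs f) _) => a.
    have /existsNP[N /not_implyP[fN nN]] := nadh a.
    by apply: filterS fN => x Nx [fx ax]; apply: nN; exists x.
  by move=> /farf[x [Nx /adhE[a xa]] fx]; apply: (Nx a).
have adhf : adh f a.
  move=> N /nbhs_interior/fa[x [xN _ xa]]; exact: xa.
have [f' [_ [u Bu ff'] adhf']] := fa _ filterT.
have d8 : 0 < d / 4 by rewrite divr_gt0.
have near_u (x : V) : nbhs x [set y : V | `|y u - x u| < d / 4].
  by apply: filterS (nbhs_ptws_box x [:: u] d8) => y; apply; rewrite mem_head.
have [s [cs sf gs tas]] := adhf _ (near_u f).
have [s' [cs' sf' gs' tas']] := adhf' _ (near_u f').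
pose z s := \sum_(j < k) m (nth f us j) s * (nth f us j) u.
have usL j : (j < k)%N -> L (nth f us j).
  by move=> jk; apply: qsL; rewrite -mem_undup mem_nth.
have zE s0 : combo L s0 -> z s0 = weight (fun p => ind good p * r p u) s0.
  move=> cs0; rewrite /z /m /weight.
  under eq_bigr do rewrite mulr_suml.
  rewrite exchange_big/= big_seq_cond [RHS]big_seq_cond.
  apply: eq_bigr => c; rewrite andbT => /(cs0.1)[_ /rqs rc].
  have rc' : (index (r c.2) us < k)%N by rewrite index_mem mem_undup.
  rewrite (bigD1 (Ordinal rc'))//= nth_index ?mem_undup// big1 ?addr0.
    rewrite -mulrA /ind; congr (_ * (_%:R * _)); congr nat_of_bool.
    by apply: asbool_equiv_eq; split=> [[]|].
  move=> j /eqP jr; rewrite /ind asboolF ?mulr0 ?mul0r//= => -[_ rj].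
  by apply: jr; apply: val_inj; rewrite /= rj index_uniq ?undup_uniq.
(* Moving good points to the net costs at most [e]; dropping the others, of mass at most [t], costs
   at most [t * M]. *)
have zb s0 : combo L s0 -> 1 - t <= weight (ind good) s0 ->
    `|bary s0 u - z s0| <= e + t * M.
  move=> cs0 gs0; rewrite zE// /bary /weight -sumrB.
  rewrite (le_trans (ler_norm_sum _ _ _))//.
  apply: (@le_trans _ _ (weight (fun p => e + (M + - M * ind good p)) s0)).
    rewrite /weight big_seq_cond [leRHS]big_seq_cond; apply: ler_sum => c.
    rewrite andbT => /(cs0.1)[c0 Lc]; rewrite -mulrBr normrM ger0_norm// ler_wpM2l//.
    have [gc|ngc] := pselect (good c.2).
      by rewrite ind_id// mul1r mulr1 subrr addr0 rgood.
    rewrite /ind asboolF// mul0r subr0 mulr0 addr0 (le_trans (L_bounded Lc Bu))//.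
    by rewrite lerDr.
  rewrite weightD (weight_cst e cs0) lerD2l weightD (weight_cst M cs0) weightZ.
  by rewrite mulNr -{1}(mulr1 M) -mulrBr mulrC ler_wpM2r// lerBlDr addrC -lerBlDr.
have zz : `|z s - z s'| <= d / 2.
  rewrite /z -sumrB (le_trans (ler_norm_sum _ _ _))//; apply: le_trans nd.
  apply: (@le_trans _ _ (\sum_(j < k) n%:R^-1 * M)); last first.
    by rewrite sumr_const card_ord [leRHS]mulr_natl.
  apply: ler_sum => j _; rewrite -mulrBl normrM ler_pM//; last first.
    exact: L_bounded (usL _ (ltn_ord j)) Bu.
  have /andP[h1 h2] := tas j; have /andP[h3 h4] := tas' j.
  rewrite -[leRHS]mulr1 ler_pdivlMl// -{1}(ger0_norm (ltW n0)) -normrM mulrBr.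
  by rewrite ler_norml; apply/andP; split; lra.
have := zb _ cs gs; have := zb _ cs' gs'; move: sf sf' zz ff' => /=.
(* The five terms add up to less than [d + 2 * (e + t * M)], that is [e' / 2 + (e + t * M)], which
   is below [e']. *)
have -> : f u - f' u = - (bary s u - f u) + (bary s u - z s) + (z s - z s') -
  (bary s' u - z s') + (bary s' u - f' u) by ring.
set x1 := _ - f u; set x2 := _ - z s; set x3 := z s - _.
set x4 := _ - z s'; set x5 := _ - f' u; move=> h1 h5 h3 far h4 h2.
have : `|- x1 + x2 + x3 - x4 + x5| <= `|x1| + `|x2| + `|x3| + `|x4| + `|x5|.
  rewrite (le_trans (ler_normD _ _))// lerD2r.
  rewrite (le_trans (ler_normD _ _))// normrN lerD2r.
  rewrite (le_trans (ler_normD _ _))// lerD2r.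
  by rewrite (le_trans (ler_normD _ _))// normrN.
by rewrite /d in h1 h3 h5 *; lra.
Qed.

End NetMasses.

(** * Envelope drop along one derivation *)

Section EnvelopeDropBase.
Variables (R : realType) (U : topologicalType).
Local Notation V := {ptws U -> R}.
Variables (L : set V) (B : set U) (M : R).
Hypothesis L_compact : compact L.
Hypothesis M_ge0 : 0 <= M.
Hypothesis L_bounded : forall p u, L p -> B u -> `|p u| <= M.
Variables (e t e' : R).
Hypotheses (e_ge0 : 0 <= e) (t_ge0 : 0 <= t) (e_small : e + t * M < e' / 2).
Local Notation der := (far_der (@far_on R U B e)).
Local Notation der' := (far_der (@far_on R U B e')).

(** The inequality on [\sum_i] says that the sets [F i] minus their derived sets are disjoint. If
    the envelope stayed above [h] on [S] near [f], combinations would gain more than [1 - t] over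
    [g], so nearly all their mass would lie in cells of radius [e], and [f1] could not be a far
    point. *)
Lemma drop_base (I : finType) (F : I -> set V) G S f W g h :
  (forall i, closed_in L (F i)) -> locmax L G ->
  (forall p, L p -> \sum_i (ind (F i) p - ind (der (F i)) p) <= 1) ->
  der' S f -> nbhs f W ->
  below L (fun p => G p + \sum_i ind (der (F i)) p) g f -> 1 - t < h - g ->
  exists f', [/\ W f', S f' & below L (fun p => G p + \sum_i ind (F i) p) h f'].
Proof.
move=> cF lG chain [_ clf] fW bf tgh.
have [f1 [[Sf1 farf1] [bf1 Wf1]]] :=
  clf _ (filterI (below_near bf) (nbhs_interior fW)).
set wA := fun p => G p + \sum_i ind (F i) p; set wB := fun p => G p + _ in bf bf1.
apply: contrapT => nex.
have nb f' : W f' -> S f' -> ~ below L wA h f'.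
  by move=> Wf' Sf' b; apply: nex; exists f'.
(* Passing from [p] to [q] can only raise [G] and gain memberships; around a [q] outside the derived
   set, [F i] stays within [e] of [q]. *)
pose E (q : V) := [set p : V | (L p -> G p <= G q) /\
  forall i, (L p -> F i p -> F i q) /\
    (F i q -> ~ der (F i) q -> F i p -> forall u, B u -> `|q u - p u| <= e)].
have [|r [qs [qsL rP bnet]]] := below_net (O := E) L_compact bf1.
  move=> q Lq; apply: filterI; first exact: lG.
  apply: (@filter_forall V I (fun i p => (L p -> F i p -> F i q) /\
    (F i q -> ~ der (F i) q -> F i p -> forall u, B u -> `|q u - p u| <= e)) (nbhs q) _).
  move=> i; apply: filterI; first exact: near_closed_in.
  have [Fq|nFq] := pselect (F i q); last by apply: filterS filterT => p _ /nFq.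
  have [dq|ndq] := pselect (der (F i) q); first by apply: filterS filterT => p _ _ [].
  have /existsNP[N /not_implyP[qN nN]] :
      ~ forall N, nbhs q N -> exists y, [/\ N y, F i y & far_on B e q y].
    by move=> H; apply: ndq; split=> //; apply: subset_closure.
  apply: filterS qN => p Np _ _ Fp u Bu; rewrite leNgt; apply/negP => far.
  by apply: nN; exists p; split=> //; exists u.
pose good := [set p | exists i, [/\ F i (r p), ~ der (F i) (r p) & F i p]].
(* At a good point the gain is at most 1, by [chain] at [r p]; at any other point each membership
   [F i p] becomes one of [r p] in the derived set. *)
have wAB p : L p -> wA p <= wB (r p) + ind good p.
  move=> Lp; have [/qsL Lrp [Gp FP]] := rP p Lp; rewrite /wA /wB -addrA lerD ?Gp//.
  have [gp|ngp] := pselect (good p).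
    rewrite (ind_id gp); have := chain _ Lrp; rewrite sumrB lerBlDl; apply: le_trans.
    by apply: ler_sum => i _; apply: ind_le; exact: (FP i).1.
  rewrite -[leLHS]addr0 lerD ?ind_ge0//; apply: ler_sum => i _; apply: ind_le => Fp.
  have Frp := (FP i).1 Lp Fp; apply: contrapT => nd; apply: ngp.
  by exists i.
pose S' := S `&` W `&` [set x | forall N, nbhs x N ->
     exists s, [/\ combo L s, N (bary s) & 1 - t <= weight (ind good) s]].
apply: (@net_masses_close R U L B M M_ge0 L_bounded r qs good e t e' S' f1) => //.
- by move=> p /rP[].
- move=> p u Lp [i [Fr nd Fp]] Bu; have [_ [_ /(_ i)[_ H]]] := rP p Lp.
  by rewrite distrC H.
- by move=> x [_].
move=> N f1N.
have [f' [Wf' [bx Nf']] [Sf' ff']] : exists2 f', W f' /\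
    ((\forall x \near f', forall s, combo L s -> bary s = x -> weight (wB \o r) s <= g)
      /\ N f') & S f' /\ far_on B e' f1 f'.
  have [f' [[Wf' [bx Nf']] Sf' ff']] := farf1 _ (filterI Wf1 (filterI (near_join bnet) f1N)).
  by exists f'.
exists f' => //; split=> //; split=> // N' f'N'.
have [s [cs [sN' sb] hs]] := not_below (nb _ Wf' Sf') (filterI f'N' bx).
exists s; split=> //; have := weight_le cs wAB; rewrite weightD.
have := sb s cs erefl; rewrite -/(weight (fun p => wB (r p)) s) => h1 h2.
by move: hs h1 h2 tgh; lra.
Qed.

End EnvelopeDropBase.

(** * Envelope drop along indecomposable ordinals *)

Section EnvelopeDrop.
Variables (R : realType) (U : topologicalType).
Local Notation V := {ptws U -> R}.
Variables (L : set V) (B : set U) (M : R).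
Hypothesis L_compact : compact L.
Hypothesis M_ge0 : 0 <= M.
Hypothesis L_bounded : forall p u, L p -> B u -> `|p u| <= M.
Variables (e t e' : R).
Hypotheses (e_ge0 : 0 <= e) (t_ge0 : 0 <= t) (e_small : e + t * M < e' / 2).
Local Notation der := (far_der (@far_on R U B e)).
Local Notation der' := (far_der (@far_on R U B e')).

Let derP := titerP (@far_der_sub _ (@far_on R U B e)).
Let der_anti (A : set V) a b : ole a b -> titer der A b `<=` titer der A a :=
  titer_anti (@far_der_sub _ (@far_on R U B e)) (a := a) (b := b).
Let der_omuln := titer_omuln (@far_der_sub _ (@far_on R U B e)) (@far_der_mono _ (@far_on R U B e)).

(** A point of [L] outside stage [a] has a neighborhood that misses an earlier stage within [L]; a
    finite net and a finite index set leave finitely many such stages, all bounded by one [b] below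
    [a]. *)
Lemma below_before_limit a (I : finType) (F : I -> set V) G f g :
  olt ozero a -> (forall b, olt b a -> olt (osucc b) a) ->
  (forall i, closed_in L (F i)) -> locmax L G ->
  below L (fun p => G p + \sum_i ind (titer der (F i) a) p) g f ->
  exists2 b, olt b a & below L (fun p => G p + \sum_i ind (titer der (F i) b) p) g f.
Proof.
move=> a0 alim cF lG bf.
have exb q : exists b, olt b a /\ (L q -> forall i, nbhs q [set p : V | L p ->
    titer der (F i) b p -> titer der (F i) a q]).
  have [Lq|nLq] := pselect (L q); last by exists ozero.
  have exi i : exists b, olt b a /\ nbhs q [set p : V | L p ->
      titer der (F i) b p -> titer der (F i) a q].
    have [aq|naq] := pselect (titer der (F i) a q).
      by exists ozero; split=> //; apply: filterS filterT => p _ _ _.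
    have [b [ba nb]] : exists b, olt b a /\ ~ titer der (F i) b q.
      have [Fq|nFq] := pselect (F i q); last by exists ozero; split=> //; rewrite titer0.
      apply: contrapT => /forallNP H; apply: naq; apply/derP; split=> // b ba.
      rewrite -titerS; apply: contrapT => nq; apply: (H (osucc b)).
      by split=> //; exact: alim.
    exists b; split=> //.
    have := near_closed_in (@closed_in_titer _ (@far_on R U B e) _ _ b (cF i)) Lq.
    by apply: filterS => p h Lp bp; have := h Lp bp.
  have [b [ba bi]] : exists b, olt b a /\ forall i, ole (projT1 (cid (exi i))) b.
    have H (s : seq I) : exists b, olt b a /\ forall i, i \in s -> ole (projT1 (cid (exi i))) b.
      elim: s => [|i s [b [ba bs]]]; first by exists ozero.
      have [d [da id bd]] := omax_lt (projT2 (cid (exi i))).1 ba.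
      exists d; split=> // j; rewrite inE => /orP[/eqP->|/bs jb]; first exact: id.
      exact: (ole_trans jb).
    have [b [ba bs]] := H (enum I); exists b; split=> // i.
    by apply: bs; rewrite mem_enum.
  exists b; split=> // _ i; have := (projT2 (cid (exi i))).2.
  by apply: filterS => p h Lp bp; apply: h => //; exact: der_anti (bi i) _ bp.
pose c q := projT1 (cid (exb q)).
have cP q : olt (c q) a /\ (L q -> forall i, nbhs q [set p : V | L p ->
    titer der (F i) (c q) p -> titer der (F i) a q]) := projT2 (cid (exb q)).
pose E (q : V) := [set p : V | (L p -> G p <= G q) /\ forall i, L p ->
    titer der (F i) (c q) p -> titer der (F i) a q].
have [|r [qs [qsL rP bnet]]] := below_net (O := E) L_compact bf.
  move=> q Lq; apply: filterI; first exact: lG.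
  apply: (@filter_forall V I (fun i p => L p ->
    titer der (F i) (c q) p -> titer der (F i) a q) (nbhs q) _).
  exact: (cP q).2.
have [b [ba bq]] : exists b, olt b a /\ forall q, q \in qs -> ole (c q) b.
  elim: (qs) => [|q s [b [ba bs]]]; first by exists ozero.
  have [d [da id bd]] := omax_lt (cP q).1 ba.
  exists d; split=> // j; rewrite inE => /orP[/eqP->|/bs jb]; first exact: id.
  exact: (ole_trans jb).
exists b => //; apply: filterS bnet => x H s cs sx; apply: le_trans (H s cs sx).
apply: weight_le cs _ => p Lp; have [rq [Gp FP]] := rP p Lp.
rewrite /= lerD ?Gp//; apply: ler_sum => i _; apply: ind_le => bp.
by apply: FP => //; exact: der_anti (bq _ rq) _ bp.
Qed.

(* The weight [G] is a spectator.  For [c <= b * m < a] with [b]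
   indecomposable, the interval [(F i), (F i)^(a)] is refined into [m]
   intervals of length [b], and the weight of the old lower ends is given a
   large multiplicity [N.+1]: a function where the refined lower weight is
   almost extremal is then almost extremal for the old one. *)
Lemma envelope_drop a : indecomposable a -> olt ozero a ->
  forall (I : finType) (F : I -> set V) G S f W g h C,
  (forall i, closed_in L (F i)) -> locmax L G ->
  (forall p, L p -> 0 <= G p <= C) ->
  (forall p, L p -> \sum_i (ind (F i) p - ind (titer der (F i) a) p) <= 1) ->
  titer der' S a f -> nbhs f W ->
  below L (fun p => G p + \sum_i ind (titer der (F i) a) p) g f -> 1 - t < h - g ->
  exists f', [/\ W f', S f' & below L (fun p => G p + \sum_i ind (F i) p) h f'].
Proof.
elim: (olt_wf a) => {}a _ IH ia a0 I F G S f W g h C cF lG GC chain af fW bf tgh.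
have [a1|a1] := pselect (a = osucc ozero).
  move: af bf chain; rewrite a1.
  have E A : titer der A (osucc ozero) = der A by rewrite titerS titer0.
  rewrite titerS titer0 => af bf chain.
  apply: (drop_base L_compact M_ge0 L_bounded e_ge0 t_ge0 e_small cF lG _ af fW _ tgh).
    by move=> p /chain; under eq_bigr do rewrite E.
  by apply: belowW bf => p _; under eq_bigr do rewrite -E.
have alim b : olt b a -> olt (osucc b) a by exact: indecomposable_osucc.
have [c ca {}bf] := below_before_limit a0 alim cF lG bf.
have [b [m [ib ba cb]]] := indecomposable_approx ia a1 ca.
have {}bf : below L (fun p => G p + \sum_i ind (titer der (F i) (omuln b m)) p) g f.
  apply: belowW bf => p Lp; rewrite lerD2l; apply: ler_sum => i _; apply: ind_le.
  exact: der_anti cb.1 _.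
have b0 : olt ozero b := omuln_gt_pos cb.
apply: contrapT => nex.
set wA := fun p => G p + \sum_i ind (F i) p in nex.
have nb f' : W f' -> S f' -> ~ below L wA h f'.
  by move=> Wf' Sf' bf'; apply: nex; exists f'.
pose D i j := iter j (fun A => titer der A b) (F i).
have DE i j : D i j = titer der (F i) (omuln b j) by rewrite der_omuln.
have cD i j : closed_in L (D i j) by rewrite DE; exact: closed_in_titer.
pose wm p := G p + \sum_i ind (D i m) p.
have bfm : below L wm g f.
  by apply: belowW bf => p _; rewrite /wm; under eq_bigr do rewrite DE.
(* A quarter of the slack in the gap: it is both the drop per round and the tolerance for [wA] being
   almost extremal. *)
pose d := (h - g - (1 - t)) / 4.
have d0 : 0 < d by rewrite divr_gt0// subr_gt0.
pose Q : R := #|I|%:R.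
have Q0 : 0 <= Q by rewrite ler0n.
have sumQ (A : I -> set V) p : 0 <= \sum_i ind (A i) p <= Q.
  rewrite sumr_ge0 => [/=|i _]; last exact: ind_ge0.
  rewrite /Q -sum1_card natr_sum; apply: ler_sum => i _; exact: ind_le1.
have sumDQ k p : 0 <= \sum_(j < k) \sum_i ind (D i j.+1) p <= k%:R * Q.
  rewrite sumr_ge0 => [/=|j _]; last by have /andP[] := sumQ (fun i => D i j.+1) p.
  rewrite -[k in k%:R]card_ord -sum1_card natr_sum mulr_suml; apply: ler_sum => j _.
  by rewrite mul1r; have /andP[] := sumQ (fun i => D i j.+1) p.
have mpos : (0 < m)%N.
  case: (m) cb => // c0; case: (@oltnn ozero).
  by apply: ole_lt_trans (ozero_le c) c0.
(* Chosen for [ND]: when the [wA]-average falls below [h - d], the resulting loss [N * d] must pay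
   for the bound [C + m * Q] on the rest of [wup]. *)
pose Z := (C + m%:R * Q - h + 2 * d + (1 - t)) / d.
pose N := (Num.truncn Z).+1.
have NZ : Z * d <= N%:R * d.
  by rewrite ler_pM2r// ltW// truncnS_gt.
have {NZ}ND : C + m%:R * Q - h + 2 * d + (1 - t) <= N%:R * d.
  by move: NZ; rewrite /Z divfK// gt_eqF.
pose G' p := N%:R * wA p + G p.
pose F' (ij : I * 'I_m) := D ij.1 ij.2.
pose wlo p := G' p + \sum_ij ind (F' ij) p.
pose wup p := G' p + \sum_ij ind (titer der (F' ij) b) p.
have wloE p : wlo p = G' p + \sum_(j < m) \sum_i ind (D i j) p.
  rewrite /wlo exchange_big/= (pair_big xpredT xpredT (fun i j => ind (D i (nat_of_ord j)) p))/=.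
  by congr (_ + _); apply: eq_bigr => -[i j].
have wupE p : wup p = G' p + \sum_(j < m) \sum_i ind (D i j.+1) p.
  rewrite /wup exchange_big/= (pair_big xpredT xpredT (fun i j => ind (D i (nat_of_ord j).+1) p))/=.
  by congr (_ + _); apply: eq_bigr => -[i j].
(* The refined intervals abut, so their lower and upper sums differ only by the extreme terms. *)
have wm_up p : wup p = wlo p - wA p + wm p.
  rewrite wupE wloE /wA /wm; have -> : \sum_i ind (F i) p = \sum_i ind (D i 0) p by [].
  have := telescope_sumr (fun j => \sum_i ind (D i j) p) (leq0n m).
  by rewrite big_mkord sumrB; lra.
have wA0 p : L p -> 0 <= wA p <= C + Q.
  move=> Lp; have /andP[G0 GC'] := GC p Lp; have /andP[s0 sQ] := sumQ F p.
  by rewrite /wA addr_ge0//= lerD.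
have lwA : locmax L wA.
  apply: locmaxD => //; apply: locmax_sum => i; exact: locmax_ind.
have lG' : locmax L G'.
  by apply: locmaxD => //; apply: locmaxZ => //; rewrite ler0n.
have GC' p : L p -> 0 <= G' p <= N%:R * (C + Q) + C.
  move=> Lp; have /andP[G0 G1] := GC p Lp; have /andP[w0 w1] := wA0 p Lp.
  by rewrite /G' addr_ge0 ?mulr_ge0 ?ler0n//= lerD// ler_wpM2l// ler0n.
have cF' ij : closed_in L (F' ij) by exact: cD.
have chain' p : L p -> \sum_ij (ind (F' ij) p - ind (titer der (F' ij) b) p) <= 1.
  move=> Lp; have := wm_up p; rewrite sumrB; have := chain p Lp; rewrite sumrB.
  have : \sum_i ind (titer der (F i) a) p <= \sum_i ind (D i m) p.
    apply: ler_sum => i _; apply: ind_le; rewrite DE; apply: der_anti.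
    exact: (indecomposable_omuln _ ia ba).1.
  by rewrite /wup /wlo /wA /wm; lra.
have wlo_ge p : L p -> N.+1%:R * wA p <= wlo p.
  move=> Lp; rewrite wloE /G' -natr1 mulrDl mul1r -addrA lerD2l /wA lerD2l.
  case: (m) mpos => // k _; rewrite big_ord_recl/= -[leLHS]addr0 lerD//.
  by have /andP[] := sumDQ k p.
(* The bound at the upper end is included as a condition that persists nearby, so that [step] can be
   repeated from the function it returns. *)
pose W' := W° `&` [set x | below L wm g x].
have step x r k : titer der' S (omuln b k.+1) x -> nbhs x W' -> W' x ->
    below L wlo r x ->
    exists x', [/\ W' x', titer der' S (omuln b k) x' & below L wlo (r - d) x'].
  rewrite omulnS (titer_add (@far_der_sub _ _) (@far_der_mono _ _)).
  move=> kx xW' [/nbhs_singleton Wx bx] br; have Sx : S x.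
    by move: kx => /(titer_sub (@far_der_sub _ _))/(titer_sub (@far_der_sub _ _)).
  apply: (IH b ba ib b0 _ F' G' _ x W' (r - d - (1 - t) - d) (r - d) _ cF' lG' GC' chain' kx xW').
    (* Since [x] lies in [S], some combination near it has [wA]-average above [h]; as [wlo]
       dominates [N.+1 * wA], the bound [r] is at least [N.+1 * h]. *)
    have [s [cs [sr _] hs]] := not_below (nb x Wx Sx) (filterI br filterT).
    have Nh : N.+1%:R * h <= r.
      apply: le_trans (sr s cs erefl); apply: le_trans (weight_le cs wlo_ge).
      by rewrite weightZ ler_wpM2l ?ler0n// ltW.
    apply: filterS (filterI br bx) => y [Hr Hm] s' cs' sy.
    have lo := Hr s' cs' sy; have wg := Hm s' cs' sy.
    have E : weight wup s' = weight wlo s' - weight wA s' + weight wm s'.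
      rewrite (_ : wup = fun p => (wlo p + (-1) * wA p) + wm p).
        by rewrite weightD (weightD wlo (fun p => -1 * wA p)) (weightZ (-1)) mulN1r.
      by apply/funext => p; rewrite wm_up mulN1r.
    have E2 : weight wup s' <= N%:R * weight wA s' + (C + m%:R * Q).
      rewrite -(weight_cst (C + m%:R * Q) cs') -weightZ -weightD.
      apply: weight_le cs' _ => p Lp; rewrite wupE /G' -addrA lerD2l lerD//.
        by have /andP[] := GC p Lp.
      by have /andP[] := sumDQ m p.
    (* An almost extremal [wA]-average turns the telescoped sum into the old gap [h - g]; otherwise
       the multiplicity [N] makes [wup] small outright. *)
    rewrite -/wup; have [le|lt] := lerP (h - d) (weight wA s').
      by rewrite E; move: lo wg le; rewrite /d; lra.
    apply: (le_trans E2).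
    have : N%:R * weight wA s' <= N%:R * (h - d) by rewrite ler_wpM2l ?ler0n// ltW.
    by move: Nh ND; rewrite -natr1; lra.
  by move: d0; lra.
have W'nbhs x : W' x -> nbhs x W'.
  by move=> [/nbhs_interior xW bx]; apply: filterI xW _; exact: below_near.
have W'f : W' f by [].
pose r0 := N%:R * (C + Q) + C + m%:R * Q.
have br0 : below L wlo r0 f.
  apply: filterS filterT => x _ s cs _; rewrite -(weight_cst r0 cs).
  apply: weight_le cs _ => p Lp; rewrite wloE lerD//.
    by have /andP[] := GC' p Lp.
  rewrite -[m in leRHS]card_ord -sum1_card natr_sum mulr_suml; apply: ler_sum => j _.
  by rewrite mul1r; have /andP[] := sumQ (fun i => D i j) p.
(* Enough rounds to push the trivial bound [r0] below 0, although [wlo] is nonnegative; their total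
   length [b * n] is still below [a]. *)
pose n := (Num.truncn (r0 / d)).+1.
have nr0 : r0 - n%:R * d < 0.
  by rewrite subr_lt0 -ltr_pdivrMr// truncnS_gt.
have iter_step k : forall x r, W' x -> titer der' S (omuln b k) x -> below L wlo r x ->
    exists x', [/\ W' x', S x' & below L wlo (r - k%:R * d) x'].
  elim: k => [|k IHk] x r Wx kx br.
    by exists x; rewrite mul0r subr0; split=> //; move: kx; rewrite titer0.
  have [x1 [W1 k1 b1]] := step _ _ _ kx (W'nbhs x Wx) Wx br.
  have [x2 [W2 S2 b2]] := IHk _ _ W1 k1 b1; exists x2; split=> //.
  by move: b2; rewrite -addrA -opprD -natr1 mulrDl mul1r [d + _]addrC.
have fn : titer der' S (omuln b n) f.
  apply: titer_anti af; first exact: far_der_sub.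
  exact: (indecomposable_omuln _ ia ba).1.
have [x [[/nbhs_singleton Wx _] Sx bx]] := iter_step n f r0 W'f fn br0.
have [s [cs [sr _] hs]] := not_below (nb x Wx Sx) (filterI bx filterT).
have := sr s cs erefl; rewrite leNgt => /negP; apply.
apply: lt_le_trans nr0 _; rewrite -(weight_cst 0 cs); apply: weight_le cs _ => p Lp.
by apply: le_trans (wlo_ge p Lp); rewrite mulr_ge0 ?ler0n//; have /andP[] := wA0 p Lp.
Qed.

End EnvelopeDrop.

(** * Derivations of the closed convex hull *)

Section ConvexHull.
Variables (R : realType) (U : topologicalType).
Local Notation V := {ptws U -> R}.
Variables (L : set V) (B : set U).

Definition hull := closure [set @bary R U s | s in combo L].

(** [envelope_drop] for the single interval from [L] to its empty stage [a]: envelope 0 at the upper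
    end would yield a function in the hull near which the indicator of [L] averages at most
    [1 - t / 2], whereas it averages 1. *)
Lemma titer_hull_eq0 (M : R) a : compact L -> (forall p u, L p -> B u -> `|p u| <= M) ->
  indecomposable a -> olt ozero a ->
  (forall e : R, 0 < e -> titer (far_der (@far_on R U B e)) L a = set0) ->
  forall e : R, 0 < e -> titer (far_der (@far_on R U B e)) hull a = set0.
Proof.
move=> cL LM ia a0 L0 e e0; apply/seteqP; split=> // f af.
pose M' := `|M|; have LM' p u : L p -> B u -> `|p u| <= M'.
  by move=> Lp Bu; rewrite (le_trans (LM p u Lp Bu))// ler_norm.
(* Makes [t * M'] at most [e / 8]; with inner scale [e / 8] the sum is below [e / 2]. *)
pose t := e / (8 * (M' + 1)).
have M1 : 0 < M' + 1 by rewrite ltr_wpDl ?normr_ge0.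
have t0 : 0 < t by rewrite divr_gt0// mulr_gt0.
have e8 : 0 < e / 8 by rewrite divr_gt0.
have small : e / 8 + t * M' < e / 2.
  have : t * M' <= t * (M' + 1) by rewrite ler_wpM2l ?lerDl// ltW.
  rewrite {2}/t invfM mulrA divfK ?gt_eqF//; lra.
have cLL : closed_in L L by exists setT; [exact: closedT|rewrite setIT].
have [] := @envelope_drop R U L B M' cL (normr_ge0 _) LM' (e / 8) t e (ltW e8) (ltW t0) small
    a ia a0 unit (fun=> L) (fun=> 0) hull f setT 0 (1 - t / 2) 0.
- by move=> _.
- by move=> q _; apply: filterS filterT => p _ _.
- by move=> p _; rewrite lexx.
- move=> p Lp; rewrite big_const/= card_unit /= addr0 L0// lerBlDr.
  by rewrite (le_trans (ind_le1 _ _))// lerDl ind_ge0.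
- exact: af.
- exact: filterT.
- apply: filterS filterT => x _ s cs _; rewrite -[leRHS](weight_cst 0 cs).
  apply: weight_le cs _ => p Lp; rewrite /= add0r big1// => i _.
  by rewrite L0// /ind asboolF.
- by rewrite subr0; move: t0; lra.
move=> f' [_ hf' b]; have [_ [[s cs <-] /(_ s cs erefl)]] := hf' _ b.
rewrite leNgt => /negP; apply; apply: (@lt_le_trans _ _ 1); first by move: t0; lra.
rewrite -(weight_cst 1 cs); apply: weight_le cs _ => p Lp.
by rewrite /= add0r big_const/= card_unit /= addr0 ind_id.
Qed.

End ConvexHull.

(** * Real-linear functionals *)

Section RealLinear.
Variables (R : realType) (k : scalar_kind).
Local Notation K := (scalars R k).
Variable X : normedModType K.
Implicit Types (p q phi : X -> R) (x y : X).

Local Notation "c .* x" := (ofR k c *: x) (at level 40).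

Definition sublinear p := (forall x y, p (x + y) <= p x + p y) /\
  (forall c x, 0 <= c -> p (c .* x) = c * p x).

Definition real_linear phi := (forall x y, phi (x + y) = phi x + phi y) /\
  (forall c x, phi (c .* x) = c * phi x).

Lemma real_linear0 phi : real_linear phi -> phi 0 = 0.
Proof. by move=> [_ h]; rewrite -(scaler0 X (ofR k 0)) h mul0r. Qed.

Lemma real_linear_sum phi (I : Type) (s : seq I) (c : I -> R) (u : I -> X) :
  real_linear phi ->
  phi (\sum_(i <- s) c i .* u i) = \sum_(i <- s) c i * phi (u i).
Proof.
move=> lp; elim: s => [|i s IH]; first by rewrite !big_nil real_linear0.
by rewrite !big_cons lp.1 lp.2 IH.
Qed.

Lemma real_linearN phi x : real_linear phi -> phi (- x) = - phi x.
Proof.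
move=> lp; apply/eqP; rewrite -addr_eq0 -lp.1 addrC subrr.
by rewrite real_linear0.
Qed.

Lemma sublinear0 p : sublinear p -> p 0 = 0.
Proof. by move=> [_ h]; rewrite -(scaler0 X (ofR k 0)) h// mul0r. Qed.

Lemma sublinear_ge p x y : sublinear p -> - p (- y) <= p (x + y) - p x.
Proof.
move=> sp; rewrite lerBrDr addrC lerBlDr (le_trans _ (sp.1 _ _))//.
by rewrite addrK.
Qed.

(* A sublinear functional below [p] that is at most [- p y] at [- y]. *)
Lemma sublinear_lower p y : sublinear p ->
  exists q, [/\ sublinear q, forall x, q x <= p x & q (- y) <= - p y].
Proof.
(* Infima along the ray in direction [y]: [t = 0] compares with [p], and [t = 1] gives the bound at
   [- y]. *)
move=> sp; pose S x := [set p (x + t .* y) - t * p y | t in [set t : R | 0 <= t]].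
have lS x : lbound (S x) (- p (- x)).
  move=> _ [t /= t0 <-]; rewrite -sp.2// [x + _]addrC.
  exact: sublinear_ge.
have S0 x : S x !=set0 by exists (p (x + 0 .* y) - 0 * p y), 0 => //=.
have hS x : has_inf (S x) by split=> //; exists (- p (- x)); exact: lS.
have leS x t : 0 <= t -> inf (S x) <= p (x + t .* y) - t * p y.
  by move=> t0; apply: ge_inf; [case: (hS x)|exists t].
have geS x b : (forall t, 0 <= t -> b <= p (x + t .* y) - t * p y) -> b <= inf (S x).
  by move=> H; apply: lb_le_inf => // _ [t t0 <-]; exact: H.
exists (fun x => inf (S x)); split.
- split=> [x z|c x c0].
    rewrite -lerBlDl; apply: (@geS) => t t0; rewrite lerBlDr -lerBlDl; apply: (@geS) => s s0.
    rewrite lerBlDl; apply: le_trans (leS _ (t + s) _) _; first exact: addr_ge0.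
    have := sp.1 (x + s .* y) (z + t .* y); rewrite ofRD scalerDl.
    rewrite (_ : _ + _ + (_ + _) = x + z + (t .* y + s .* y)); first by lra.
    by rewrite addrACA [s .* y + _]addrC.
  have [->|cn0] := eqVneq c 0.
    rewrite mul0r ofR0 scale0r; apply/eqP; rewrite eq_le; apply/andP; split.
      by have := leS 0 0 (lexx _); rewrite ofR0 scale0r addr0 sublinear0// mul0r subr0.
    by apply: (@geS) => t t0; rewrite add0r sp.2// subrr.
  have cp : 0 < c by rewrite lt_neqAle eq_sym cn0.
  have cV d z : ofR k c *: (z + (d / c) .* y) = ofR k c *: z + d .* y.
    by rewrite scalerDr scalerA -ofRM mulrC divfK.
  apply/eqP; rewrite eq_le; apply/andP; split.
    rewrite -ler_pdivrMl//; apply: (@geS) => t t0.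
    rewrite ler_pdivrMl//; apply: le_trans (leS _ (t * c) _) _; first by rewrite mulr_ge0.
    have := cV (t * c) x; rewrite mulfK// => <-; rewrite sp.2//.
    by rewrite mulrBr mulrA [c * t]mulrC.
  apply: (@geS) => t t0; rewrite -cV sp.2// -ler_pdivlMl// mulrBr mulKf//.
  by rewrite mulrA [c^-1 * t]mulrC; apply: leS; rewrite divr_ge0.
- by move=> x; have := leS x 0 (lexx _); rewrite ofR0 scale0r addr0 mul0r subr0.
- have := leS (- y) 1 ler01; rewrite (_ : ofR k 1 = 1); last by case: (k).
  by rewrite scale1r addNr sublinear0// mul1r sub0r.
Qed.

(** Zorn's lemma: the infimum of a chain is again sublinear, and finite since members are at least
    [- p (- x)] at [x]. *)
Lemma minimal_sublinear p : sublinear p ->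
  exists q, [/\ sublinear q, forall x, q x <= p x &
    forall q', sublinear q' -> (forall x, q' x <= q x) -> q' = q].
Proof.
move=> sp; pose P (q : X -> R) := sublinear q /\ forall x, q x <= p x; pose T := {q | P q}.
pose r (q q' : T) := `[< forall x, sval q' x <= sval q x >].
have Teq (q q' : T) : sval q = sval q' -> q = q'.
  by case: q q' => [q hq] [q' hq'] /= E; subst q'; congr exist; exact: Prop_irrelevance.
have p0 : T by exists p.
have [q qmin] : exists q : T, forall q' : T, r q q' -> q' = q.
  apply: Zorn => [q|q1 q2 q3 /asboolP h1 /asboolP h2|q1 q2 /asboolP h1 /asboolP h2|A Atot].
  - exact/asboolP.
  - by apply/asboolP => x; exact: le_trans (h2 x) (h1 x).
  - by apply/Teq/funext => x; apply/eqP; rewrite eq_le h1 h2.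
  have [[a Aa]|nA] := pselect (A !=set0); last first.
    by exists p0 => s As; case: nA; exists s.
  pose S x := [set sval (q : T) x | q in A].
  have lS x : lbound (S x) (- p (- x)).
    move=> _ [[q [sq qp]] _ <-] /=; rewrite lerNl (le_trans _ (qp _))//.
    by have := sq.1 x (- x); rewrite subrr sublinear0//; lra.
  have hS x : has_inf (S x).
    by split; [exists (sval a x), a|exists (- p (- x)); exact: lS].
  have leS x (q : T) : A q -> inf (S x) <= sval q x.
    by move=> Aq; apply: ge_inf; [case: (hS x)|exists q].
  have geS x b : (forall q : T, A q -> b <= sval q x) -> b <= inf (S x).
    by move=> H; apply: lb_le_inf => [|_ [q Aq <-]]; [case: (hS x)|exact: H].
  have st : sublinear (fun x => inf (S x)).
    split=> [x y|c x c0].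
      rewrite -lerBlDl; apply: (@geS) => q1 A1; rewrite lerBlDr -lerBlDl.
      apply: (@geS) => q2 A2; rewrite lerBlDl.
      have [/asboolP h|/asboolP h] := Atot _ _ A1 A2.
        apply: le_trans (leS _ _ A2) _; apply: le_trans ((svalP q2).1.1 _ _) _.
        by rewrite addrC lerD2r h.
      apply: le_trans (leS _ _ A1) _; apply: le_trans ((svalP q1).1.1 _ _) _.
      by rewrite addrC lerD2l h.
    have [->|cn0] := eqVneq c 0.
      rewrite mul0r ofR0 scale0r; apply/eqP; rewrite eq_le; apply/andP; split.
        by apply: le_trans (leS _ _ Aa) _; rewrite (sublinear0 (svalP a).1).
      by apply: (@geS) => q _; rewrite (sublinear0 (svalP q).1).
    have cp : 0 < c by rewrite lt_neqAle eq_sym cn0.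
    apply/eqP; rewrite eq_le; apply/andP; split.
      rewrite -ler_pdivrMl//; apply: (@geS) => q Aq; rewrite ler_pdivrMl//.
      by rewrite -(svalP q).1.2//; exact: leS.
    by apply: (@geS) => q Aq; rewrite (svalP q).1.2// ler_pM2l// leS.
  have tp x : inf (S x) <= p x by apply: le_trans (leS _ _ Aa) _; exact: (svalP a).2.
  by exists (exist P _ (conj st tp)) => q Aq; apply/asboolP => x; exact: leS.
exists (sval q); split; [exact: (svalP q).1|exact: (svalP q).2|].
move=> q' sq' q'q; have q'p x : q' x <= p x.
  by apply: le_trans (q'q x) _; exact: (svalP q).2.
have := qmin (exist P q' (conj sq' q'p)); move=> <- //; exact/asboolP.
Qed.

(** Instead of extending from a subspace: a minimal sublinear functional cannot be lowered by
    [sublinear_lower], hence is odd and so linear. Lowering [p] at [x0] beforehand fixes the value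
    there. *)
Lemma hahn_banach p x0 : sublinear p ->
  exists phi, [/\ real_linear phi, forall x, phi x <= p x & phi x0 = p x0].
Proof.
move=> sp; have [p' [sp' p'p p'x0]] := sublinear_lower x0 sp.
have [q [sq qp' qmin]] := minimal_sublinear sp'.
have qN x : q (- x) = - q x.
  have [q2 [sq2 q2q q2x]] := sublinear_lower x sq.
  have E := qmin _ sq2 q2q; subst q2.
  apply/eqP; rewrite eq_le q2x/=; have := sq.1 x (- x).
  by rewrite subrr sublinear0//; lra.
have qD x y : q (x + y) = q x + q y.
  apply/eqP; rewrite eq_le sq.1/=; have := sq.1 (x + y) (- y).
  by rewrite addrK qN; lra.
exists q; split.
- split=> // c x; have [c0|c0] := leP 0 c; first exact: sq.2.
  have := sq.2 (- c) x; rewrite oppr_ge0 => /(_ (ltW c0)).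
  have -> : (- c) .* x = - (c .* x).
    by rewrite -scaleNr; congr (_ *: _); case: (k) => //=; rewrite rmorphN.
  by rewrite qN mulNr => /oppr_inj.
- by move=> x; exact: le_trans (qp' x) (p'p x).
- apply/eqP; rewrite eq_le (le_trans (qp' _) (p'p _))/=.
  by have := qp' (- x0); rewrite qN; move: p'x0; lra.
Qed.

(* If no point of the hull is close to [f] on a finite set, the difference
   between [f] and an almost nearest point of the hull separates. *)
Lemma bipolar (L : set {ptws X -> R}) (f : X -> R) :
  (forall p, L p -> real_linear p) -> real_linear f ->
  (forall u, exists M, forall p : {ptws X -> R}, L p -> `|p u| <= M) ->
  (forall u e, 0 < e -> exists2 p : {ptws X -> R}, L p & f u <= p u + e) ->
  hull L f.
Proof.
move=> lL lf bL fL N /nbhs_ptws_boxP[s [e [e0 eN]]].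
have [p0 Lp0 _] := fL 0 1 ltr01.
pose D (c : seq (R * {ptws X -> R})) := \sum_(u <- s) (bary c u - f u) ^+ 2.
apply: contrapT => nN.
have De c : combo L c -> e ^+ 2 <= D c.
  move=> cc; have [u us ue] : exists2 u, u \in s & e <= `|bary c u - f u|.
    apply: contrapT => nu; apply: nN; exists (bary c); split; first by exists c.
    apply: eN => u us; rewrite ltNge; apply/negP => ue; apply: nu.
    by exists u.
  rewrite /D (perm_big _ (perm_to_rem us)) big_cons.
  apply: (@le_trans _ _ ((bary c u - f u) ^+ 2)).
    by rewrite -[leRHS]real_normK ?num_real// lerXn2r// nnegrE// ltW.
  by rewrite lerDl sumr_ge0// => v _; rewrite sqr_ge0.
have combo0 p : L p -> combo L [:: (1, p)].
  by move=> Lp; split=> [c|]; rewrite ?inE ?big_seq1// => /eqP ->; split.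
pose S := [set D c | c in combo L].
have hS : has_inf S.
  split; first by exists (D [:: (1, p0)]), [:: (1, p0)] => //; exact: combo0.
  by exists (e ^+ 2) => _ [c cc <-]; exact: De.
pose d := inf S.
have d0 : 0 < d.
  apply: (@lt_le_trans _ _ (e ^+ 2)); first exact: exprn_gt0.
  by apply: lb_le_inf; [case: hS|move=> _ [c cc <-]; exact: De].
have dD c : combo L c -> d <= D c by move=> cc; apply: ge_inf; [case: hS|exists c].
pose m u := projT1 (cid (bL u)).
have mP u (p : {ptws X -> R}) : L p -> `|p u| <= m u := projT2 (cid (bL u)) p.
have mbary u c : combo L c -> `|bary c u| <= m u.
  move=> cc; rewrite -(weight_cst (m u) cc) (le_trans (ler_norm_sum _ _ _))// /weight.
  rewrite big_seq_cond [leRHS]big_seq_cond; apply: ler_sum => x.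
  by rewrite andbT => /(cc.1)[x0 Lx]; rewrite normrM ger0_norm// ler_wpM2l// mP.
pose Q := \sum_(u <- s) (2 * m u) ^+ 2.
have Q0 : 0 <= Q by apply: sumr_ge0 => u _; exact: sqr_ge0.
pose t := Num.min 1 (d / (2 * (Q + 1))).
have t0 : 0 < t by rewrite lt_min ltr01 divr_gt0// mulr_gt0// ltr_wpDl.
have t1 : t <= 1 by rewrite ge_min lexx.
have tQ : t * Q <= d / 2.
  apply: (@le_trans _ _ (t * (Q + 1))); first by rewrite ler_wpM2l ?lerDl// ltW.
  have : t <= d / (2 * (Q + 1)) by rewrite ge_min lexx orbT.
  by rewrite ler_pdivlMr ?mulr_gt0 ?ltr_wpDl//; lra.
(* The tolerance [t * (d / 2)] is proportional to [t], because it is weighed against the first-order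
   effect of a step of length [t]. *)
have [_ [c cc <-] cd] := inf_adherent (mulr_gt0 t0 (divr_gt0 d0 (ltr0Sn R 1))) hS.
rewrite -/d in cd.
pose a u := f u - bary c u.
(* On real-linear functionals, evaluation at [z] is the scalar product with [a] over [s]. *)
pose z := \sum_(u <- s) a u .* u.
have [p Lp] := fL z (d / 4) (divr_gt0 d0 (ltr0Sn R 3)).
rewrite leNgt => /negP; apply; rewrite /z !real_linear_sum//; last exact: lL.
pose b u := p u - bary c u.
(* A step of length [t] from [c] towards [p]. It cannot bring [D] below [d], which bounds the scalar
   product of [a] and [b] by [d / 2]. *)
pose c' : seq (R * {ptws X -> R}) := (t, p) :: [seq ((1 - t) * v.1, v.2) | v <- c].
have cc' : combo L c'.
  split=> [x|].
    rewrite inE => /orP[/eqP->/=|/mapP[y /(cc.1)[y0 Ly] ->]/=].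
      by split=> //; exact: ltW.
    by split=> //; rewrite mulr_ge0// subr_ge0.
  by rewrite big_cons big_map/= -mulr_sumr cc.2 mulr1 addrC subrK.
have bary' u : bary c' u - f u = - (a u - t * b u).
  rewrite /bary big_cons big_map/=.
  under eq_bigr do rewrite -mulrA.
  by rewrite -mulr_sumr /a /b /bary; ring.
have D' : D c' = D c - 2 * t * (\sum_(u <- s) a u * b u) + t ^+ 2 * \sum_(u <- s) b u ^+ 2.
  rewrite /D !mulr_sumr -sumrB -big_split/=; apply: eq_bigr => u _.
  by rewrite bary' /a; ring.
have bQ : \sum_(u <- s) b u ^+ 2 <= Q.
  apply: ler_sum => u _; rewrite -[leLHS]real_normK ?num_real// lerXn2r ?nnegrE//.
    by rewrite mulr_ge0// (le_trans (normr_ge0 (p u)))// mP.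
  rewrite (le_trans (ler_normB _ _))// mulr_natl mulr2n; apply: lerD; [exact: mP|exact: mbary].
have := dD _ cc'; rewrite D'; set r := \sum_(u <- s) a u * b u => h.
have : 2 * t * r <= t * d.
  have : t ^+ 2 * \sum_(u <- s) b u ^+ 2 <= t * (d / 2).
    rewrite expr2 -mulrA ler_pM2l// (le_trans _ tQ)// ler_pM2l//.
  by move: cd h; lra.
rewrite [2 * t]mulrC -mulrA ler_pM2l// => xd.
have -> : \sum_(u <- s) a u * p u = \sum_(u <- s) a u * f u - (D c - r).
  rewrite /D /r -!sumrB; apply: eq_bigr => u _; rewrite /a /b; ring.
by have := dD _ cc; move: xd d0; lra.
Qed.

End RealLinear.

(** * Weak-star topology and duality *)

Section WeakStar.
Variables (R : realType) (k : scalar_kind).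
Local Notation K := (scalars R k).

Lemma toRD (z w : K) : toR (z + w) = toR z + toR w.
Proof. by case: k z w => //= -[a b] [c d]. Qed.

Lemma toRN (z : K) : toR (- z) = - toR z.
Proof. by case: k z => //= -[a b]. Qed.

Lemma toRB (z w : K) : toR (z - w) = toR z - toR w.
Proof. by rewrite toRD toRN. Qed.

Lemma toRZ (c : R) (z : K) : toR (ofR k c * z) = c * toR z.
Proof. by case: k z => //= -[a b] /=; rewrite mul0r subr0. Qed.

Lemma toR_norm (z : K) : `|toR z| <= toR `|z|.
Proof.
by case: k z => //= -[a b] /=; rewrite -sqrtr_sqr ler_wsqrtr// lerDl sqr_ge0.
Qed.

(** With multipliers 1 and [i] in the complex case, convergence of real parts at all vectors
    controls full convergence. *)
Lemma norm_toR_bound : exists c1 c2 : K, forall z : K,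
  `|z| <= ofR k (`|toR (c1 * z)| + `|toR (c2 * z)|).
Proof.
case: k => /=.
  by exists 1, 1 => z; rewrite mul1r lerDl.
exists 1, 'i%C => -[a b]; rewrite normc_def mul1r.
have -> : 'i%C * (a +i* b)%C = (- b +i* a)%C :> R[i] by simpc.
rewrite lecR /= normrN -ler_sqr ?nnegrE ?addr_ge0//.
rewrite sqr_sqrtr ?addr_ge0 ?sqr_ge0// sqrrD !real_normK ?num_real//.
by rewrite addrAC lerDl mulrn_wge0// mulr_ge0.
Qed.

(** Multiplying [x] by a scalar of modulus 1 turns [f x] into its modulus. *)
Lemma norm_le_toR (X : normedModType K) (f : X -> K) :
  linear f -> (forall x, toR (f x) <= toR `|x|) -> forall x, `|f x| <= `|x|.
Proof.
move=> lf H x; have [->|z0] := eqVneq (f x) 0; first by rewrite normr0.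
have fZ a y : f (a *: y) = a * f y.
  have := lf a y 0; have := lf (-1) 0 0.
  by rewrite !addr0 scaler0 scaleN1r addNr => ->; rewrite addr0.
have := H ((`|f x| / f x) *: x); rewrite fZ divfK// normrZ normrM normfV normr_id.
rewrite divff ?normr_eq0// mul1r => h.
by rewrite -(toRK (normr_ge0 (f x))) -(toRK (normr_ge0 x)) ofR_le.
Qed.

Lemma bounded_op_real_linear (X : normedModType K) (f : dual X) :
  real_linear (fun x => toR (f x)).
Proof.
by split=> [x y|c x]; [rewrite linearD toRD|rewrite linearZ toRZ].
Qed.

Lemma real_linear_toR (X : normedModType K) (phi : X -> R) :
  real_linear phi -> exists2 f : X -> K, linear f & forall x, toR (f x) = phi x.
Proof.
case: k X phi => X phi lphi.
  by exists phi => // a x y; rewrite lphi.1; congr (_ + _); exact: lphi.2.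
exists (fun x => (phi x +i* - phi ('i%C *: x))%C) => // -[a b] x y.
have E : forall x, phi ((a +i* b)%C *: x) = a * phi x + b * phi ('i%C *: x).
  move=> z; rewrite -!lphi.2 -lphi.1 scalerA -scalerDl; congr (phi (_ *: _)).
  by rewrite /=; simpc.
have E' : phi ('i%C *: ((a +i* b)%C *: x)) = a * phi ('i%C *: x) - b * phi x.
  rewrite scalerA mulrC -scalerA E scalerA (_ : 'i%C * 'i%C = -1 :> R[i]); last first.
    by rewrite -expr2 sqr_i.
  by rewrite scaleN1r real_linearN// mulrN.
rewrite scalerDr !lphi.1 E E'; apply/eqP; rewrite eq_complex/=.
by apply/andP; split; apply/eqP; ring.
Qed.

Lemma dual_of_real_linear (X : normedModType K) (phi : X -> R) :
  real_linear phi -> (forall x, phi x <= toR `|x|) ->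
  exists2 f : dual X, dual_ball X f & forall x, toR (f x) = phi x.
Proof.
move=> /real_linear_toR[f lf fphi] phiN.
have fN : forall x, `|f x| <= `|x|.
  by apply: norm_le_toR => // x; rewrite fphi.
have fP : f \in bounded_op_pred X (K^o).
  by apply: (@bounded_linear_op _ _ _ _ f 1) => // x; rewrite mul1r fN.
exists (BoundedOp fP) => //; rewrite /dual_ball/=.
by apply: bounded_op_norm_le => // x; rewrite mul1r; exact: fN.
Qed.

Lemma sublinear_norm (X : normedModType K) : sublinear (fun x : X => toR `|x|).
Proof.
split=> [x y|c x c0]; first by rewrite -toRD toR_le// ler_normD.
by rewrite normrZ ger0_norm ?toRZ// -(ofR0 R k) ofR_le.
Qed.

Lemma norming_functional (X : normedModType K) (x : X) :
  exists2 f : dual X, dual_ball X f & toR (f x) = toR `|x|.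
Proof.
have [phi [lphi phiN phix]] := hahn_banach x (sublinear_norm X).
by have [f fb fphi] := dual_of_real_linear lphi phiN; exists f; rewrite ?fphi.
Qed.

Lemma ofR_lt (x y : R) : (ofR k x < ofR k y) = (x < y).
Proof. by case: k => //=; rewrite ltcR. Qed.

Lemma toR_lt (z : K) (e : R) : 0 <= z -> (toR z < e) = (z < ofR k e).
Proof. by move=> z0; rewrite -ofR_lt toRK. Qed.

Lemma toR_continuous : continuous (@toR R k : K^o -> R).
Proof.
move=> z; apply/(@cvgrPdist_lt _ _ _ _ (nbhs_filter (z : K^o))) => e e0.
have e0' : 0 < ofR k e by rewrite -(ofR0 R k) ofR_lt.
have zB := nbhsx_ballx (z : K^o) _ e0'.
apply: (@filterS _ (nbhs (z : K^o)) (nbhs_filter (z : K^o)) _ _ _ zB) => w.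
rewrite -ball_normE /= => zw; rewrite -toRB (le_lt_trans (toR_norm _))//.
by rewrite toR_lt.
Qed.

Lemma weak_star_eval (X : normedModType K) (x : X) :
  continuous ((fun f => toR ((f : dual X) x)) : weak_star X -> R).
Proof.
move=> f; apply: (@continuous_comp (weak_star X) {ptws X -> K^o} R
  (fun f : dual X => (f : {ptws X -> K^o})) (fun g => toR (g x))).
  exact: initial_continuous.
apply: (@continuous_comp {ptws X -> K^o} K^o R (fun g => g x) (@toR R k)).
  exact: (@proj_continuous X (fun=> K^o) x).
exact: toR_continuous.
Qed.

Lemma weak_star_cvg (X : normedModType K) (F : set_system (weak_star X)) (f : dual X) :
  Filter F -> (forall x, (fun g : weak_star X => toR ((g : dual X) x)) @ F --> toR (f x)) ->
  F --> (f : weak_star X).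
Proof.
move=> FF H.
have cf : (fun g : weak_star X => (g : dual X) : {ptws X -> K^o}) @ F -->
    ((f : X -> K) : {ptws X -> K^o}).
  apply/pointwise_cvgP => x; apply/cvgrPdist_lt => e e0.
  have [c1 [c2 cP]] := norm_toR_bound.
  have eE : ofR k (toR e) = e by rewrite toRK// ltW.
  have e20 : 0 < toR e / 2 by rewrite divr_gt0// -ofR_lt eE ofR0.
  have /cvgrPdist_lt/(_ _ e20) h1 := H (c1 *: x).
  have /cvgrPdist_lt/(_ _ e20) h2 := H (c2 *: x).
  apply: filterS (filterI h1 h2) => g [/= g1 g2].
  apply: le_lt_trans (cP _) _; rewrite -eE ofR_lt [ltRHS]splitr.
  by rewrite !mulrBr -!linearZ !toRB ltrD.
move=> V [_ [[W oW <-] Wf] WV].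
apply: filterS WV _; apply: (cf W); exact: open_nbhs_nbhs.
Qed.

(** Banach-Alaoglu: along an ultrafilter the real parts converge at each vector, and the limits form
    a real-linear functional dominated by the norm, which is the real part of a member of the
    ball. *)
Lemma dual_ball_compact (X : normedModType K) :
  compact (dual_ball X : set (weak_star X)).
Proof.
rewrite compact_ultra => F FU Fb.
have FF : ProperFilter F by exact: ultra_proper.
pose ev x (f : weak_star X) := toR ((f : dual X) x).
have ex x : exists l : R, (ev x @ F --> l) /\ l <= toR `|x|.
  have [|l [/= lx Fl]] := @segment_compact R (- toR `|x|) (toR `|x|) (ev x @ F) _.
    apply: (@filterS _ F _ (dual_ball X) _ _ Fb) => f fb.
    rewrite /= in_itv/= -ler_norml.
    rewrite /ev (le_trans (toR_norm _))// toR_le//.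
    by rewrite (le_trans (bounded_op_le f x))// ler_piMl.
  exists l; split; last by move: lx; rewrite in_itv/= => /andP[].
  move=> V lV; have [//|nV] := in_ultra_setVsetC (ev x @^-1` V) FU.
  have nV' : (ev x @ F) (~` V) by [].
  by have [y []] := Fl _ _ nV' lV.
pose phi x := projT1 (cid (ex x)).
have phiP x : ev x @ F --> phi x := (projT2 (cid (ex x))).1.
have phiN x : phi x <= toR `|x| := (projT2 (cid (ex x))).2.
have uniq x l : ev x @ F --> l -> l = phi x.
  by move=> Fl; exact: (@cvg_unique _ _ (ev x @ F) _ _ _ Fl (phiP x)).
have lphi : real_linear phi.
  split=> [x y|c x]; apply/esym/uniq.
    rewrite (_ : ev _ = fun f => ev x f + ev y f); first exact: cvgD.
    by apply/funext => f; rewrite /ev linearD toRD.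
  rewrite (_ : ev _ = fun f => c * ev x f); first exact: cvgMr.
  by apply/funext => f; rewrite /ev linearZ toRZ.
have [f fb fphi] := dual_of_real_linear lphi phiN.
exists f; split=> //=; apply: weak_star_cvg => x; rewrite fphi; exact: phiP.
Qed.

End WeakStar.

(** * Functionals on injective tensor products *)

Section TensorFunctional.
Variables (R : realType) (k : scalar_kind).
Local Notation K := (scalars R k).

Lemma weak_star_evalK (X : normedModType K) (x : X) :
  continuous ((fun f => (f : dual X) x) : weak_star X -> K^o).
Proof.
move=> f; apply: (@continuous_comp (weak_star X) {ptws X -> K^o} (K^o)
  (fun f : dual X => (f : {ptws X -> K^o})) (fun g => g x)).
  exact: initial_continuous.
exact: (@proj_continuous X (fun=> K^o) x).
Qed.

Variables X Y : normedModType K.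
Local Notation W := (injective_tensor X Y).
Implicit Types (g : dual X) (h : dual Y) (u w : W).

Lemma tensor_functional_le g h u : `|g (injective_tensor_val u h)| <= `|g| * `|h| * `|u|.
Proof.
rewrite (le_trans (bounded_op_le _ _))// -mulrA ler_wpM2l// mulrC.
exact: bounded_op_le.
Qed.

Lemma tensor_functionalP g h :
  (fun u => g (injective_tensor_val u h)) \in bounded_op_pred W (K^o).
Proof.
apply: (@bounded_linear_op _ _ _ _ _ (`|g| * `|h|)) => [|a u v|u].
- by rewrite mulr_ge0.
- by rewrite /= linearP.
- exact: tensor_functional_le.
Qed.

Definition tensor_functional g h : dual W := BoundedOp (tensor_functionalP g h).

Lemma tensor_functional_norm g h : `|tensor_functional g h| <= `|g| * `|h|.
Proof.
by apply: bounded_op_norm_le => [|u]; [rewrite mulr_ge0|exact: tensor_functional_le].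
Qed.

Lemma tensor_norm_le (x : X) (y : Y) : `|tensor x y| <= `|x| * `|y|.
Proof.
rewrite injective_tensor_normE; apply: bounded_op_norm_le => [|h].
  by rewrite mulr_ge0.
by rewrite /= normrZ mulrC -mulrA ler_wpM2l// mulrC bounded_op_le.
Qed.

Lemma tensor_approx u (e : K) : 0 < e -> exists n (x : 'I_n -> X) (y : 'I_n -> Y),
  `|u - \sum_(i < n) tensor (x i) (y i)| < e.
Proof.
move=> e0; have /asboolP/(_ _ (nbhsx_ballx (injective_tensor_val u) _ e0)) :=
  injective_tensorP u.
move=> [_ [[n [x [y ->]]]]]; rewrite -ball_normE /= => uxy.
by exists n, x, y; rewrite injective_tensor_normE /= tensor_sum_val.
Qed.

Lemma injective_tensor_ext (Z : normedModType K) (S T : bounded_op W Z) :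
  (forall x y, S (tensor x y) = T (tensor x y)) -> S = T.
Proof.
move=> ST; apply: bounded_op_eq => u; apply/eqP; rewrite -subr_eq0 -normr_le0.
apply/ler_addgt0Pr => e e0; rewrite add0r.
have d0 : 0 < e / (`|S - T| + 1) by rewrite divr_gt0// ltr_wpDl.
have [n [x [y uxy]]] := tensor_approx u d0; set v := \sum_(i < n) _ in uxy.
have -> : S u - T u = (S - T) (u - v).
  have STv : (S - T) v = 0.
    rewrite linear_sum big1// => i _.
    by rewrite -[LHS]/(S (tensor (x i) (y i)) - T (tensor (x i) (y i))) ST subrr.
  by rewrite -[LHS]/((S - T) u) -[LHS]subr0 -[in LHS]STv -linearB.
rewrite (le_trans (bounded_op_le _ _))//.
rewrite (@le_trans _ _ (`|S - T| * (e / (`|S - T| + 1))))//.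
  by rewrite ler_wpM2l// ltW.
by rewrite mulrCA ger_pMr// ler_pdivrMr ?mul1r ?lerDl// ltr_wpDl.
Qed.

Lemma tensor_functional_ge (g : dual X) (h : dual Y) x y :
  `|g x| * `|h y| <= `|tensor_functional g h| * (`|x| * `|y|).
Proof.
have -> : `|g x| * `|h y| = `|tensor_functional g h (tensor x y)|.
  by rewrite /= linearZ normrM mulrC.
by rewrite (le_trans (bounded_op_le _ _))// ler_wpM2l// tensor_norm_le.
Qed.

(** Fixing [h] and testing on tensors with a [y] where [h] does not vanish recovers the norm of [g];
    this gives the lower Lipschitz bound for slices. *)
Lemma tensor_functional_gel (g : dual X) (h : dual Y) y : h y != 0 ->
  `|h y| * `|g| <= `|y| * `|tensor_functional g h|.
Proof.
move=> hy; have hy0 : 0 < `|h y| by rewrite normr_gt0.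
rewrite mulrC -ler_pdivlMr//; apply: bounded_op_norm_le => [|x].
  by rewrite divr_ge0// mulr_ge0.
rewrite mulrAC ler_pdivlMr// (le_trans (tensor_functional_ge _ _ _ _))//.
by rewrite mulrA mulrAC [`|y| * _]mulrC.
Qed.

Lemma tensor_functional_ger (g : dual X) (h : dual Y) x : g x != 0 ->
  `|g x| * `|h| <= `|x| * `|tensor_functional g h|.
Proof.
move=> gx; have gx0 : 0 < `|g x| by rewrite normr_gt0.
rewrite mulrC -ler_pdivlMr//; apply: bounded_op_norm_le => [|y].
  by rewrite divr_ge0// mulr_ge0.
rewrite mulrAC ler_pdivlMr// mulrC (le_trans (tensor_functional_ge _ _ _ _))//.
by rewrite mulrA [`|x| * _]mulrC.
Qed.

(* Joint weak-star continuity holds on bounded sets only. *)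
Lemma tensor_functional_cvg (a b : K) (F : set_system (weak_star X * weak_star Y))
    g0 h0 : Filter F -> 0 <= a -> 0 <= b -> F --> ((g0 : weak_star X), (h0 : weak_star Y)) ->
  (\forall z \near F, `|z.1 : dual X| <= a /\ `|z.2 : dual Y| <= b) ->
  `|g0| <= a -> `|h0| <= b -> forall u,
  (fun z => toR ((z.1 : dual X) (injective_tensor_val u (z.2 : dual Y)))) @ F -->
  toR (g0 (injective_tensor_val u h0)).
Proof.
move=> FF a0 b0 Fz Fab g0a h0b u.
pose val (v : W) (z : weak_star X * weak_star Y) : K^o :=
  (z.1 : dual X) (injective_tensor_val v (z.2 : dual Y)).
suff H : val u @ F --> (g0 (injective_tensor_val u h0) : K^o).
  apply: (@cvg_comp _ _ _ (val u) (@toR R k : K^o -> R) F _ _ H).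
  exact: toR_continuous.
have F1 x : (fun z : weak_star X * weak_star Y => (z.1 : dual X) x : K^o) @ F --> (g0 x : K^o).
  apply: (@cvg_comp _ _ _ fst (fun f : weak_star X => (f : dual X) x : K^o) F
    (nbhs (g0 : weak_star X))).
    by apply: cvg_trans (cvg_app fst Fz) _; exact: cvg_fst.
  exact: weak_star_evalK.
have F2 y : (fun z : weak_star X * weak_star Y => (z.2 : dual Y) y : K^o) @ F --> (h0 y : K^o).
  apply: (@cvg_comp _ _ _ snd (fun f : weak_star Y => (f : dual Y) y : K^o) F
    (nbhs (h0 : weak_star Y))).
    by apply: cvg_trans (cvg_app snd Fz) _; exact: cvg_snd.
  exact: weak_star_evalK.
have ab1 : 0 < a * b + 1 by rewrite ltr_wpDl// mulr_ge0.
apply/cvgrPdist_lt => e e0.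
have d0 : 0 < e / 4 / (a * b + 1) by rewrite !divr_gt0.
(* On the finite sum [v] the functional is a polynomial in evaluations, so convergence is joint; the
   error from [u] to [v] is at most [e / 4] uniformly on the bounded pairs. *)
have [n [x [y uxy]]] := tensor_approx u d0; set v := \sum_(i < n) _ in uxy.
have vE (g : dual X) (h : dual Y) : g (injective_tensor_val v h) = \sum_(i < n) h (y i) * g (x i).
  rewrite /v tensor_sum_val.
  transitivity (tensor_functional g h v).
    by rewrite /= tensor_sum_val.
  by rewrite linear_sum; apply: eq_bigr => i _; rewrite /= linearZ.
have Fv : val v @ F --> (g0 (injective_tensor_val v h0) : K^o).
  rewrite vE (_ : val v = fun z => \sum_(i < n) ((z.2 : dual Y) (y i) * (z.1 : dual X) (x i))).
    elim: (index_enum _) => [|i s IHs].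
      rewrite big_nil (_ : (fun _ => _) = cst 0); first exact: cvg_cst.
      by apply/funext => z; rewrite big_nil.
    rewrite big_cons (_ : (fun _ => _) = fun z => (z.2 : dual Y) (y i) * (z.1 : dual X) (x i) +
      \sum_(i <- s) ((z.2 : dual Y) (y i) * (z.1 : dual X) (x i))); last first.
      by apply/funext => z; rewrite big_cons.
    by apply: cvgD IHs; apply: cvgM; [exact: F2|exact: F1].
  by apply/funext => z; exact: vE.
have close (g : dual X) (h : dual Y) : `|g| <= a -> `|h| <= b ->
    `|g (injective_tensor_val u h) - g (injective_tensor_val v h)| <= e / 4.
  move=> ga hb; have -> : g (injective_tensor_val u h) - g (injective_tensor_val v h) =
      tensor_functional g h (u - v) by rewrite linearB.
  rewrite (le_trans (tensor_functional_le _ _ _))//.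
  rewrite (@le_trans _ _ (a * b * (e / 4 / (a * b + 1))))//.
    by rewrite ler_pM// ?mulr_ge0// ?ler_pM// ltW.
  rewrite mulrCA ger_pMr ?divr_gt0// ler_pdivrMr// mul1r lerDl//.
have e20 : 0 < e / 2 by rewrite divr_gt0.
have /cvgrPdist_lt/(_ _ e20) Fv2 := Fv.
apply: filterS (filterI Fv2 Fab) => -[g h] [/= vz [ga hb]].
rewrite -(subrKA (g0 (injective_tensor_val v h0))).
have -> : e = e / 4 + (e / 2 + e / 4) by field.
rewrite (le_lt_trans (ler_normD _ _))// ler_ltD ?close//.
rewrite -(subrKA (g (injective_tensor_val v h))) (le_lt_trans (ler_normD _ _))//.
by rewrite ltr_leD// distrC close.
Qed.

End TensorFunctional.

Section TensorAdjoint.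
Variables (R : realType) (k : scalar_kind).
Local Notation K := (scalars R k).

Lemma tensor_op_tensor (X X1 Y Y1 : normedModType K) (A : bounded_op X X1)
  (B : bounded_op Y Y1) x y : tensor_op A B (tensor x y) = tensor (A x) (B y).
Proof.
have := @tensor_opP _ _ _ _ _ _ A B 1 (fun=> x) (fun=> y).
by rewrite !big_ord1.
Qed.

Lemma tensor_op_adjoint (X X1 Y Y1 : normedModType K) (A : bounded_op X X1)
    (B : bounded_op Y Y1) (g : dual X1) (h : dual Y1) :
  adjoint (tensor_op A B) (tensor_functional g h) =
  tensor_functional (adjoint A g) (adjoint B h).
Proof.
apply: injective_tensor_ext => x y.
by rewrite /= tensor_op_tensor /= !linearZ.
Qed.

Lemma opnorm_attained (X Y : normedModType K) (f : bounded_op X Y) (e : R) :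
  0 < e -> exists2 x, `|x| <= 1 & toR `|f| <= toR `|f x| + e.
Proof.
move=> e0; have [_ [x x1 <-] h] := sup_adherent e0 (opnorm_has_sup f).
by exists x => //; rewrite normE ofRK -lerBlDr ltW.
Qed.

End TensorAdjoint.

(** * Szlenk index *)

Section SzlenkIndex.
Variables (R : realType) (k : scalar_kind).
Local Notation K := (scalars R k).

Lemma diam_gtP (X : normedModType K) (e : R) (A : set (dual X)) :
  (e%:E < diam A)%E <-> exists f g, [/\ A f, A g & e < toR `|f - g|].
Proof.
split=> [/ereal_sup_gt[_ [f Af [g Ag <-]]]|[f [g [Af Ag h]]]].
  by rewrite lte_fin => h; exists f, g.
apply: (@lt_le_trans _ _ (toR `|f - g|)%:E); first by rewrite lte_fin.
by apply: ereal_sup_ubound; exists f => //; exists g.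
Qed.

Lemma szlenk_derivation_mono (X : normedModType K) (e : R) (A A' : set (dual X)) :
  A `<=` A' -> szlenk_derivation e A `<=` szlenk_derivation e A'.
Proof.
move=> AA' f [Af H]; split=> [|V /H/diam_gtP[g [h [[Vg Ag] [Vh Ah] gh]]]]; first exact: AA'.
by apply/diam_gtP; exists g, h; split=> //; split=> //; exact: AA'.
Qed.

Definition far_norm (X : normedModType K) (e : R) (f g : weak_star X) : Prop :=
  e < toR `|(f : dual X) - (g : dual X)|.

(** Of two points more than [e] apart, one is more than [e / 2] from [f]: the diameter condition
    becomes a one-point condition at half the scale. *)
Lemma szlenk_derivation_far (X : normedModType K) (e : R) (A : set (dual X)) :
  szlenk_derivation e A `<=` far_der (@far_norm X (e / 2)) (A : set (weak_star X)).
Proof.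
move=> f [Af H]; split=> //; apply: subset_closure; split=> // V /H/diam_gtP.
move=> [g [h [[Vg Ag] [Vh Ah] gh]]].
have : e < toR `|f - g| + toR `|f - h|.
  apply: lt_le_trans gh _; rewrite -toRD toR_le//.
  by rewrite -(subrKA f) (le_trans (ler_normD _ _))// lerD2r distrC.
have [fg _|fg fh] := ltP (e / 2) (toR `|f - g|); first by exists g.
exists h; split; [exact: Vh|exact: Ah|rewrite /far_norm].
by move: (toR `|f - g|) (toR `|f - h|) fg fh => p q; clear; lra.
Qed.

Lemma far_szlenk_derivation (X : normedModType K) (e : R) (A : set (dual X)) :
  far_der (@far_norm X e) (A : set (weak_star X)) `<=` szlenk_derivation e A.
Proof.
move=> f [Af clf]; split=> // V fV; have [g [[Ag H] Vg]] := clf _ (nbhs_interior fV).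
have [h [Vh Ah gh]] := H _ Vg; apply/diam_gtP; exists g, h; split=> //.
by split=> //; exact: nbhs_singleton.
Qed.

Lemma titer_far_szlenk (X : normedModType K) (e : R) (A : set (dual X)) a :
  titer (far_der (@far_norm X e)) (A : set (weak_star X)) a `<=`
  titer (szlenk_derivation e) A a.
Proof.
move=> f; apply: (@titer_map (weak_star X) (dual X) (far_der (@far_norm X e))
  (szlenk_derivation e) (@far_der_sub _ _) (@far_der_mono _ _)
  (@szlenk_derivation_sub _ _ _ _) (@szlenk_derivation_mono _ _) (fun f => f)) => //.
move=> D D' g _ DD' Dg; apply: (@szlenk_derivation_mono _ _ D) => //.
exact: far_szlenk_derivation.
Qed.

Lemma Sz_leP (X : normedModType K) (A : set (dual X)) a : xle (Sz A) (XOrd a) <->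
  forall e : R, 0 < e -> titer (szlenk_derivation e) A a = set0.
Proof.
split=> [Aa e e0|H].
  have := xsup_ub (fun e : {posnum R} => Sz_eps e%:num A) (PosNum e0).
  rewrite -/(Sz A) /Sz_eps; case: pselect => [h /= le|_].
    have {}le : ole (omin h) a.
      by case: (Sz A) Aa le => [b ba hb|]; [exact: (ole_trans hb)|].
    apply/seteqP; split=> // f af; have := ominP h; rewrite -[set0]/(set0) => <-.
    by apply: titer_anti af => //; exact: szlenk_derivation_sub.
  by case: (Sz A) Aa.
apply: xsup_le => e; rewrite /Sz_eps; case: pselect => [h|nh] /=.
  by apply: omin_le; exact: H.
by apply: nh; exists a; exact: H.
Qed.

Lemma titer_szlenk_map (X X' : normedModType K) (theta : dual X -> dual X')
    (A : set (dual X)) (A' : set (dual X')) (c e : R) a f :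
  0 < c -> (forall f, A f -> A' (theta f)) ->
  (forall f, A f -> forall V : set (weak_star X'), nbhs (theta f : weak_star X') V ->
    nbhs (f : weak_star X) [set g | A g -> V (theta g)]) ->
  (forall f g, A f -> A g -> c * toR `|f - g| <= toR `|theta f - theta g|) ->
  titer (szlenk_derivation e) A a f -> titer (szlenk_derivation (c * e)) A' a (theta f).
Proof.
move=> c0 AA' cont lip.
apply: (titer_map (@szlenk_derivation_sub _ _ _ _) (@szlenk_derivation_mono _ _)
  (@szlenk_derivation_sub _ _ _ _) (@szlenk_derivation_mono _ _)) => //.
move=> D D' g DA DD' [Dg H]; split; first exact: DD'.
move=> V gV; have /H/diam_gtP[p [q [[Vp Dp] [Vq Dq] pq]]] := cont _ (DA _ Dg) _ gV.
apply/diam_gtP; exists (theta p), (theta q); split.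
- by split; [exact: Vp (DA _ Dp)|exact: DD'].
- by split; [exact: Vq (DA _ Dq)|exact: DD'].
- by apply: lt_le_trans (lip _ _ (DA _ Dp) (DA _ Dq)); rewrite ltr_pM2l.
Qed.

Lemma Sz_map (X X' : normedModType K) (theta : dual X -> dual X')
    (A : set (dual X)) (A' : set (dual X')) (c : R) :
  0 < c -> (forall f, A f -> A' (theta f)) ->
  (forall f, A f -> forall V : set (weak_star X'), nbhs (theta f : weak_star X') V ->
    nbhs (f : weak_star X) [set g | A g -> V (theta g)]) ->
  (forall f g, A f -> A g -> c * toR `|f - g| <= toR `|theta f - theta g|) ->
  xle (Sz A) (Sz A').
Proof.
move=> c0 AA' cont lip; case E : (Sz A') => [a|]; last by case: (Sz A).
apply/Sz_leP => e e0; have /Sz_leP/(_ (c * e)) : xle (Sz A') (XOrd a).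
  by rewrite E /=; exact: ole_refl.
rewrite mulr_gt0// => /(_ isT) A0; apply/seteqP; split=> // f.
by move=> /(titer_szlenk_map c0 AA' cont lip); rewrite A0.
Qed.

(** Let [f] be in stage [b] and [g] in stage [c]. Averaging [f] with any point of [A] stays in stage
    [b] at half the scale, so averaging with [f] maps [A] into that stage, and then takes [g] to
    stage [b + c]. *)
Lemma midpoint_indecomposable (X : normedModType K) (A : set (dual X)) a :
  A !=set0 -> (forall f g, A f -> A g -> A (ofR k 2^-1 *: (f + g))) ->
  Sz A = XOrd a -> indecomposable a /\ olt ozero a.
Proof.
move=> [f0 Af0] mid SzA; have SzP b : ole a b <->
    forall e : R, 0 < e -> titer (szlenk_derivation e) A b = set0.
  by rewrite -Sz_leP SzA.
have h0 : 0 < (2^-1 : R) by rewrite invr_gt0.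
split; last first.
  have [/SzP/(_ 1 ltr01)|//] := ole_or_lt a ozero.
  by rewrite titer0 => A0; case: (A0 : A = set0) => A0'; rewrite A0' in Af0.
have ex b : olt b a -> exists2 e : R, 0 < e & titer (szlenk_derivation e) A b !=set0.
  move=> ba; apply: contrapT => nex; case: (olt_le_false ba); apply/SzP => e e0.
  apply: contrapT => /eqP/set0P ne; apply: nex; by exists e.
have antie (e d : R) b : d <= e ->
    titer (szlenk_derivation e) A b `<=` titer (szlenk_derivation d) A b.
  move=> de f; apply: (titer_map (@szlenk_derivation_sub _ _ _ _) (@szlenk_derivation_mono _ _)
    (@szlenk_derivation_sub _ _ _ _) (@szlenk_derivation_mono _ _) (phi := id)) => //.
  move=> D D' g _ DD' [Dg H]; split; first exact: DD'.
  move=> V /H/diam_gtP[p [q [[Vp Dp] [Vq Dq] pq]]]; apply/diam_gtP.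
  exists p, q; split; [by split; [|exact: DD']|by split; [|exact: DD']|].
  exact: le_lt_trans pq.
have sE (p q : dual X) x :
    toR ((ofR k 2^-1 *: (p + q)) x) = 2^-1 * (toR (p x) + toR (q x)).
  by rewrite -toRD -toRZ.
have shift (B : set (dual X)) h : (forall f, A f -> B (ofR k 2^-1 *: (f + h))) ->
    forall (e : R) b f, titer (szlenk_derivation e) A b f ->
      titer (szlenk_derivation (2^-1 * e)) B b (ofR k 2^-1 *: (f + h)).
  move=> AB e b f; apply: (titer_szlenk_map h0 (theta := fun f => ofR k 2^-1 *: (f + h))) => //.
    move=> g _ V gV.
    suff cv : (fun g : weak_star X => ofR k 2^-1 *: ((g : dual X) + h) : weak_star X) @
        nbhs (g : weak_star X) --> (ofR k 2^-1 *: (g + h) : weak_star X).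
      apply: (@filterS _ (nbhs (g : weak_star X)) (nbhs_filter _) _ _ _ (cv _ gV)).
      by move=> z Vz _; exact: Vz.
    apply: weak_star_cvg => x.
    suff : (fun z : weak_star X => 2^-1 * (toR ((z : dual X) x) + toR (h x))) @
        nbhs (g : weak_star X) --> toR ((ofR k 2^-1 *: (g + h)) x).
      rewrite (_ : (fun _ => _) = fun z : weak_star X =>
        toR ((ofR k 2^-1 *: ((z : dual X) + h)) x)) => [//|].
      by apply/funext => z; rewrite sE.
    rewrite sE; apply: cvgMr; apply: cvgD; last exact: cvg_cst.
    exact: weak_star_eval.
  move=> p q _ _; rewrite -scalerBr normrZ ger0_norm ?toRZ; last first.
    by rewrite -(ofR0 R k) ofR_le ltW.
  by rewrite opprD addrACA subrr addr0.
move=> b c /ex[e e0 [f Af]] /ex[d d0 [g Ag]].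
pose m := Num.min e d; have m0 : 0 < m by rewrite lt_min e0.
have {}Af : titer (szlenk_derivation m) A b f by apply: antie Af; rewrite ge_min lexx.
have {}Ag : titer (szlenk_derivation m) A c g by apply: antie Ag; rewrite ge_min lexx orbT.
have AB h : A h -> titer (szlenk_derivation (2^-1 * m)) A b (ofR k 2^-1 *: (h + f)).
  move=> Ah; rewrite addrC; apply: shift Af => p Ap; exact: mid.
have := shift _ _ AB _ _ _ Ag; rewrite -titer_add; last exact: szlenk_derivation_mono.
  move=> ne; have [/SzP/(_ (2^-1 * m))|//] := ole_or_lt a (oadd b c).
  by rewrite mulr_gt0// => /(_ isT) E; rewrite E in ne.
exact: szlenk_derivation_sub.
Qed.

End SzlenkIndex.

Section AdjointBall.
Variables (R : realType) (k : scalar_kind).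
Local Notation K := (scalars R k).

Definition adjoint_ball (X X1 : normedModType K) (A : bounded_op X X1) : set (dual X) :=
  adjoint A @` dual_ball X1.

Variables (X X1 : normedModType K) (A : bounded_op X X1).

Lemma adjoint_ball_norm f : adjoint_ball A f -> `|f| <= `|A|.
Proof.
move=> [g g1 <-]; rewrite (le_trans (bounded_op_comp_norm _ _))//.
by rewrite ler_piMl.
Qed.

Lemma adjoint_ball0 : adjoint_ball A !=set0.
Proof.
by exists (adjoint A 0), 0 => //; rewrite /dual_ball/= normr0.
Qed.

Lemma adjoint_ball_mid f g : adjoint_ball A f -> adjoint_ball A g ->
  adjoint_ball A (ofR k 2^-1 *: (f + g)).
Proof.
move=> [f' f1 <-] [g' g1 <-]; exists (ofR k 2^-1 *: (f' + g')); last first.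
  by rewrite linearZ linearD.
have h0 : (0 : R) <= 2^-1 by rewrite invr_ge0.
rewrite /dual_ball/= normrZ ger0_norm; last by rewrite -(ofR0 R k) ofR_le.
have -> : 1 = ofR k 2^-1 * (1 + 1) :> K.
  have one : ofR k 1 = 1 by case: (k).
  by rewrite -{1 2 3}one -ofRD -ofRM mulVf.
by rewrite ler_wpM2l ?(le_trans (ler_normD _ _)) ?lerD// -(ofR0 R k) ofR_le.
Qed.

Lemma adjoint_ball_compact : compact (adjoint_ball A : set (weak_star X)).
Proof.
apply: (@continuous_compact (weak_star X1) (weak_star X) (adjoint A) (dual_ball X1)); last first.
  exact: dual_ball_compact.
apply: (@continuous_subspaceT (weak_star X1) (weak_star X) _ (adjoint A)) => f.
apply: (@weak_star_cvg R k X (adjoint A @ nbhs (f : weak_star X1)) (adjoint A f)).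
by move=> x; exact: (@weak_star_eval R k X1 (A x) f).
Qed.

End AdjointBall.

(** * The two inequalities *)

Section InjectiveTensorSzlenk.
Variables (R : realType) (k : scalar_kind).
Local Notation K := (scalars R k).
Variables (X X1 Y Y1 : normedModType K).
Variables (A : bounded_op X X1) (B : bounded_op Y Y1).
Local Notation W := (injective_tensor X Y).
Local Notation T := (tensor_op A B).
Local Notation KA := (adjoint_ball A).
Local Notation KB := (adjoint_ball B).
Local Notation KT := (adjoint_ball T).
Local Notation V := {ptws W -> R}.

Let P : set (weak_star X * weak_star Y) := (KA : set (weak_star X)) `*` (KB : set (weak_star Y)).

Let phi (z : weak_star X * weak_star Y) : V :=
  fun u => toR ((z.1 : dual X) (injective_tensor_val u (z.2 : dual Y))).

Let P_compact : compact P.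
Proof. by apply: compact_setX; exact: adjoint_ball_compact. Qed.

Let phi_continuous : {within P, continuous phi}.
Proof.
apply/subspace_continuousP => -[g h] [/= Ag Bh].
apply/pointwise_cvgP => u.
apply: (@tensor_functional_cvg R k X Y `|A| `|B| (within P (nbhs (g, h))) g h) => //.
- by apply: cvg_within.
- by rewrite near_withinE; apply: filterS filterT => -[g' h'] _
    [/= /adjoint_ball_norm ? /adjoint_ball_norm ?].
- exact: adjoint_ball_norm.
- exact: adjoint_ball_norm.
Qed.

Let unit_ball : set W := [set u | `|u| <= 1].

Lemma toR_ge0 (z : K) : 0 <= z -> 0 <= toR z.
Proof. by move=> z0; rewrite -(ofR_le k) ofR0 toRK. Qed.

Let phi_bound z u : P z -> `|phi z u| <= toR (`|A| * `|B| * `|u|).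
Proof.
move=> [/adjoint_ball_norm hA /adjoint_ball_norm hB].
rewrite (le_trans (toR_norm _))// toR_le// (le_trans (tensor_functional_le _ _ _))//.
by rewrite ler_wpM2r// ler_pM.
Qed.

(** Lifted to [P], slices that are far on the unit ball come from pairs far in one factor, so the
    product estimate applies. *)
Lemma titer_tensor_image a : indecomposable a -> olt ozero a ->
  (forall e : R, 0 < e -> titer (szlenk_derivation e) KA a = set0) ->
  (forall e : R, 0 < e -> titer (szlenk_derivation e) KB a = set0) ->
  forall e : R, 0 < e -> titer (far_der (@far_on R W unit_ball e)) (phi @` P) a = set0.
Proof.
move=> ia a0 hA hB e e0.
(* Pairs within [d] in both factors have slices within [d * toR |B| + toR |A| * d] on the unit ball,
   at most [d * c]; the summand 1 keeps [c] positive. *)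
pose c := toR `|A| + toR `|B| + 1.
have nA : 0 <= toR `|A| by exact: toR_ge0.
have nB : 0 <= toR `|B| by exact: toR_ge0.
have c0 : 0 < c by rewrite ltr_wpDl// addr_ge0.
pose d := e / c; have d0 : 0 < d by rewrite divr_gt0.
have fA : titer (far_der (@far_norm R k X d)) (KA : set (weak_star X)) a = set0.
  by apply/seteqP; split=> // f /titer_far_szlenk; rewrite hA.
have fB : titer (far_der (@far_norm R k Y d)) (KB : set (weak_star Y)) a = set0.
  by apply/seteqP; split=> // f /titer_far_szlenk; rewrite hB.
apply/seteqP; split=> // p.
have hV : hausdorff_space V by apply: hausdorff_product => _; exact: Rhausdorff.
move=> /(titer_far_image P_compact phi_continuous hV)[z zP _].
suff : titer (far_der (far_prod (@far_norm R k X d) (@far_norm R k Y d))) P a z.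
  by move=> /(titer_far_setX ia a0); rewrite fA fB => -[[]|[]].
apply: (titer_map (@far_der_sub _ _) (@far_der_mono _ _)
  (@far_der_sub _ _) (@far_der_mono _ _) (phi := id)) zP => //.
move=> D D' x DP DD' [Dx clx]; split; first exact: DD'.
apply: closure_subset clx => y [Dy H]; split=> [|N /H[w [Nw Dw [u u1 yw]]]]; first exact: DD'.
exists w; split=> //; first exact: DD'.
apply: contrapT => /not_orP[/negP n1 /negP n2]; move: yw; apply/negP.
rewrite -leNgt in n1; rewrite -leNgt in n2; rewrite -leNgt /phi.
have [_ /adjoint_ball_norm yB] := DP _ Dy; have [/adjoint_ball_norm wA _] := DP _ Dw.
have le1 : `|((y.1 : dual X) - (w.1 : dual X)) (injective_tensor_val u (y.2 : dual Y))| <=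
    ofR k (d * toR `|B|).
  rewrite (le_trans (tensor_functional_le _ _ _))// ofRM toRK//.
  rewrite (@le_trans _ _ (`|(y.1 : dual X) - (w.1 : dual X)| * `|y.2 : dual Y|))//.
    by rewrite ler_piMr// mulr_ge0.
  by rewrite ler_pM// -(toRK (normr_ge0 _)) ofR_le.
have le2 : `|(w.1 : dual X) (injective_tensor_val u ((y.2 : dual Y) - (w.2 : dual Y)))| <=
    ofR k (toR `|A| * d).
  rewrite (le_trans (tensor_functional_le _ _ _))// ofRM toRK//.
  rewrite (@le_trans _ _ (`|w.1 : dual X| * `|(y.2 : dual Y) - (w.2 : dual Y)|))//.
    by rewrite ler_piMr// mulr_ge0.
  by rewrite ler_pM// -(toRK (normr_ge0 _)) ofR_le.
rewrite -toRB (le_trans (toR_norm _))//.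
have -> : e = d * c by rewrite /d divfK// gt_eqF.
apply: (@le_trans _ _ (d * toR `|B| + toR `|A| * d)); last first.
  by rewrite [toR `|A| * d]mulrC -mulrDr ler_pM2l// /c [toR `|A| + _]addrC lerDl.
rewrite -(ofR_le k) toRK// ofRD; apply: le_trans (lerD le1 le2).
apply: le_trans (ler_normD _ _); rewrite linearB linearB.
by rewrite -[X in `|X + _|]/((y.1 : dual X) _ - (w.1 : dual X) _) subrKA.
Qed.

(* A functional [F] of norm at most one satisfies [|F (T u)| <= |T u|], and
   [|T u|] is the supremum of [Re (g (T u h))] over the two dual balls. *)
Lemma tensor_adjoint_ball_hull f : KT f ->
  hull (phi @` P) (fun u => toR (f u) : R).
Proof.
move=> [F F1 <-]; apply: (@bipolar R k W).
- move=> _ [z _ <-].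
  exact: (bounded_op_real_linear (tensor_functional (z.1 : dual X) (z.2 : dual Y))).
- exact: (bounded_op_real_linear (adjoint T F)).
- by move=> u; exists (toR (`|A| * `|B| * `|u|)) => _ [z Pz <-]; exact: phi_bound.
move=> u e e0; have [h h1 uh] := opnorm_attained (injective_tensor_val (T u)) e0.
have [g g1 gE] := norming_functional (injective_tensor_val (T u) h).
exists (phi (adjoint A g, adjoint B h)).
  exists (adjoint A g, adjoint B h) => //; split; first by exists g.
  by exists h.
have -> : phi (adjoint A g, adjoint B h) u = toR (g (injective_tensor_val (T u) h)).
  rewrite /phi -[LHS]/(toR (tensor_functional (adjoint A g) (adjoint B h) u)).
  by rewrite -tensor_op_adjoint.
rewrite gE; apply: le_trans uh.
apply: le_trans (ler_norm _) _; rewrite (le_trans (toR_norm _))// toR_le//.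
by rewrite -injective_tensor_normE (le_trans (bounded_op_le F (T u)))// ler_piMl.
Qed.

Lemma far_norm_far_on (e : R) (f g : dual W) : far_norm e f g ->
  far_on unit_ball e (fun u => toR (f u) : R) (fun u => toR (g u) : R).
Proof.
rewrite /far_norm => efg; apply: contrapT => nfar.
have H u : `|u| <= 1 -> `|toR ((f - g) u)| <= e.
  move=> u1; rewrite leNgt; apply/negP => h; apply: nfar; exists u => //.
  by rewrite -toRB.
have : toR `|f - g| <= e.
  rewrite normE ofRK; apply: opnorm_le => u u1.
  have [->|z0] := eqVneq ((f - g) u) 0.
    rewrite normr0 (_ : toR 0 = 0); last by rewrite -(ofR0 R k) ofRK.
    by have := H 0; rewrite normr0 ler01 => /(_ isT); apply: le_trans.
  pose c := `|(f - g) u| / (f - g) u.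
  have := H (c *: u); rewrite normrZ /c normrM normfV normr_id.
  rewrite divff ?normr_eq0// mul1r => /(_ u1); apply: le_trans.
  rewrite linearZ /= -[(_ / _) *: _]/(_ / _ * _) divfK//; exact: ler_norm.
by rewrite leNgt efg.
Qed.

(** Real parts carry [KT] continuously into the hull and still detect norm distances on the unit
    ball; the scale is halved by the one-point form of the derivation. *)
Lemma titer_tensor_adjoint_ball a : indecomposable a -> olt ozero a ->
  (forall e : R, 0 < e -> titer (szlenk_derivation e) KA a = set0) ->
  (forall e : R, 0 < e -> titer (szlenk_derivation e) KB a = set0) ->
  forall e : R, 0 < e -> titer (szlenk_derivation e) KT a = set0.
Proof.
move=> ia a0 hA hB e e0; apply/seteqP; split=> // f.
have L0 := titer_tensor_image ia a0 hA hB.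
have cL : compact (phi @` P) by exact: continuous_compact phi_continuous P_compact.
have bL (p : V) u : (phi @` P) p -> unit_ball u -> `|p u| <= toR (`|A| * `|B|).
  move=> [z Pz <-] u1; rewrite (le_trans (phi_bound _ Pz))// toR_le ?mulr_ge0//.
  by rewrite ler_piMr// mulr_ge0.
have := titer_hull_eq0 cL bL ia a0 L0 (divr_gt0 e0 (ltr0Sn R 1)).
pose rho (g : dual W) : V := fun u => toR (g u).
move=> H af; suff : titer (far_der (far_on unit_ball (e / 2))) (hull (phi @` P)) a (rho f).
  by rewrite H.
apply: (titer_map (@szlenk_derivation_sub _ _ _ _) (@szlenk_derivation_mono _ _ _ _)
  (@far_der_sub _ _) (@far_der_mono _ _) (phi := rho)) af => //.
  exact: tensor_adjoint_ball_hull.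
move=> D D' g DK DD' /szlenk_derivation_far[Dg clg]; split; first exact: DD'.
have crho : continuous (rho : weak_star W -> V).
  move=> x; apply/(@pointwise_cvgP W R (rho @ nbhs (x : weak_star W)) (rho x) _) => u.
  exact: (@weak_star_eval R k W u x).
move=> N gN; have [x [[Dx Hx] Nx]] := clg _ (crho g _ (nbhs_interior gN)).
exists (rho x); split; last exact: nbhs_singleton.
split=> [|N' xN']; first exact: DD'.
have [y [Ny Dy xy]] := Hx _ (crho x _ xN').
exists (rho y); split=> //; [exact: DD'|exact: far_norm_far_on].
Qed.

Lemma exists_adjoint_ball_neq0 (Z Z1 : normedModType K) (C : bounded_op Z Z1) :
  C != 0 -> exists g z, [/\ dual_ball Z1 g, adjoint C g z != 0 & 0 < `|z|].
Proof.
move=> C0; have [z Cz] : exists z, C z != 0.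
  apply: contrapT => nC; move/negP: C0; apply; apply/eqP/bounded_op_eq => z.
  by apply/eqP; apply: contrapT => /negP Cz; apply: nC; exists z.
have [g g1 gz] := norming_functional (C z).
have gz0 : adjoint C g z != 0.
  apply: contra_neq Cz => /(congr1 (@toR R k)); rewrite /= gz => n0.
  apply/eqP; rewrite -normr_eq0 -(toRK (normr_ge0 _)) n0.
  by rewrite -{1}(ofR0 R k) ofRK ofR0.
exists g, z; split=> //; rewrite normr_gt0.
by apply: contraNneq gz0 => ->; rewrite linear0.
Qed.

Lemma toR_div_gt0 (x t : K) : x != 0 -> 0 < t -> 0 < toR (`|x| / t).
Proof.
move=> x0 t0; have q0 : 0 < `|x| / t by rewrite divr_gt0// normr_gt0.
by rewrite -(ofR_lt k) toRK ?ofR0// ltW.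
Qed.

(** Slices with a fixed nonzero [adjoint B h] embed [KA] into [KT]. They are weak-star continuous in
    [g], since [u] applied to the fixed functional is a vector of [X]. *)
Lemma Sz_op_left : B != 0 -> xle (Sz_op A) (Sz_op T).
Proof.
move=> /exists_adjoint_ball_neq0[h [y [h1 hy y0]]].
apply: (Sz_map (A := KA) (A' := KT)
  (theta := fun g => tensor_functional g (adjoint B h)) (toR_div_gt0 hy y0)).
- move=> _ [g g1 <-]; exists (tensor_functional g h); last exact: tensor_op_adjoint.
  rewrite /dual_ball/= (le_trans (tensor_functional_norm _ _))//.
  by rewrite mulr_ile1.
- move=> g _ N gN.
  have cv : (fun g : weak_star X => tensor_functional (g : dual X) (adjoint B h) : weak_star W) @
      nbhs (g : weak_star X) --> (tensor_functional g (adjoint B h) : weak_star W).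
    apply: weak_star_cvg => u.
    exact: (@weak_star_eval R k X (injective_tensor_val u (adjoint B h)) g).
  apply: (@filterS _ (nbhs (g : weak_star X)) (nbhs_filter _) _ _ _ (cv _ gN)).
  by move=> z Nz _; exact: Nz.
move=> f g _ _; rewrite -(ofR_le k) ofRM !toRK ?divr_ge0//.
have -> : tensor_functional f (adjoint B h) - tensor_functional g (adjoint B h) =
    tensor_functional (f - g) (adjoint B h) by exact: bounded_op_eq.
by rewrite mulrAC ler_pdivrMr// [leRHS]mulrC tensor_functional_gel.
Qed.

(** Not a mirror image of the left case: for fixed [g], the slice is visibly an evaluation of [h] at
    a vector of [Y] only when [u] is a finite sum, so continuity is taken on the bounded set
    [KB]. *)
Lemma Sz_op_right : A != 0 -> xle (Sz_op B) (Sz_op T).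
Proof.
move=> /exists_adjoint_ball_neq0[g [x [g1 gx x0]]].
apply: (Sz_map (A := KB) (A' := KT)
  (theta := fun h => tensor_functional (adjoint A g) h) (toR_div_gt0 gx x0)).
- move=> _ [h h1 <-]; exists (tensor_functional g h); last exact: tensor_op_adjoint.
  rewrite /dual_ball/= (le_trans (tensor_functional_norm _ _))//.
  by rewrite mulr_ile1.
- move=> h Bh N hN.
  pose F := within (KB : set (weak_star Y)) (nbhs (h : weak_star Y)).
  suff cv : (fun h : weak_star Y => tensor_functional (adjoint A g) (h : dual Y) : weak_star W) @
      F --> (tensor_functional (adjoint A g) h : weak_star W).
    exact: (cv _ hN).
  apply: weak_star_cvg => u.
  apply: (@tensor_functional_cvg R k X Y `|adjoint A g| `|B|
    ((fun h : weak_star Y => (adjoint A g : weak_star X, h)) @ F) (adjoint A g) h) => //.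
  + apply: (@cvg_pair _ _ _ _ (nbhs (adjoint A g : weak_star X)) (nbhs (h : weak_star Y))).
      exact: cvg_cst.
    exact: cvg_within.
  + rewrite near_simpl near_withinE; apply: filterS filterT => h' _ /adjoint_ball_norm h'B.
    by split.
  + exact: adjoint_ball_norm.
move=> f h _ _; rewrite -(ofR_le k) ofRM !toRK ?divr_ge0//.
have -> : tensor_functional (adjoint A g) f - tensor_functional (adjoint A g) h =
    tensor_functional (adjoint A g) (f - h).
  by apply: bounded_op_eq => u; rewrite /= !linearB.
by rewrite mulrAC ler_pdivrMr// [leRHS]mulrC tensor_functional_ger.
Qed.

End InjectiveTensorSzlenk.

Lemma xle_anti a b : xle a b -> xle b a -> a = b.
Proof. by case: a b => [a|] [b|]//= ab ba; congr XOrd; exact: ole_anti. Qed.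

Lemma xle_total a b : xle a b \/ xle b a.
Proof.
case: a b => [a|] [b|]; [|by left|by right|by left].
by have [ab|[ba _]] := ole_or_lt a b; [left|right].
Qed.

Lemma xle_refl a : xle a a. Proof. by case: a => //= a; exact: ole_refl. Qed.

Lemma xmax_cases a b : [/\ xle a (xmax a b), xle b (xmax a b) & xmax a b = a \/ xmax a b = b].
Proof.
rewrite /xmax; case: pselect => [ab|nab]; first by split=> //; [exact: xle_refl|right].
by split; [exact: xle_refl|case: (xle_total a b)|left].
Qed.

Section TensorOperators.
Variables (R : realType) (k : scalar_kind).
Local Notation K := (scalars R k).

Lemma Sz_tensor_op (X X1 Y Y1 : normedModType K) (A : bounded_op X X1)
    (B : bounded_op Y Y1) : A != 0 -> B != 0 ->
  Sz_op (tensor_op A B) = xmax (Sz_op A) (Sz_op B).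
Proof.
move=> A0 B0; have [leA leB maxE] := xmax_cases (Sz_op A) (Sz_op B).
apply: xle_anti; last first.
  by case: maxE => ->; [exact: Sz_op_left|exact: Sz_op_right].
case E : (xmax _ _) leA leB maxE => [a|] leA leB maxE; last by case: (Sz_op _).
(* A maximum other than [XInfty] is the index of one of two nonempty midpoint-convex sets, which
   supplies what the hull estimate asks of [a]. *)
have [ia a0] : indecomposable a /\ olt ozero a.
  case: maxE => [/esym|/esym].
    apply: midpoint_indecomposable; first exact: adjoint_ball0.
    exact: adjoint_ball_mid.
  apply: midpoint_indecomposable; first exact: adjoint_ball0.
  exact: adjoint_ball_mid.
apply/Sz_leP; apply: titer_tensor_adjoint_ball => //; exact/Sz_leP.
Qed.

Lemma id_boundedP (X : normedModType K) : (@id X) \in bounded_op_pred X X.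
Proof. by apply/asboolP; split=> // x; exact: cvg_id. Qed.

Definition id_op (X : normedModType K) : bounded_op X X := BoundedOp (id_boundedP X).

Lemma Sz_op_id (X : normedModType K) : Sz_op (id_op X) = Sz_space X.
Proof.
rewrite /Sz_op /Sz_space; congr Sz; apply/seteqP; split=> f.
  by move=> [g g1 <-]; rewrite (_ : adjoint _ g = g)//; exact: bounded_op_eq.
by move=> f1; exists f => //; exact: bounded_op_eq.
Qed.

Lemma tensor_op_id (X Y : normedModType K) :
  tensor_op (id_op X) (id_op Y) = id_op (injective_tensor X Y).
Proof. by apply: injective_tensor_ext => x y; rewrite tensor_op_tensor. Qed.

Lemma id_op_neq0 (X : normedModType K) : (exists x : X, x != 0) -> id_op X != 0.
Proof.
move=> [x]; apply: contra_neq => id0.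
by rewrite -[LHS]/(id_op X x) id0.
Qed.

Lemma Sz_injective_tensor (X Y : normedModType K) :
  (exists x : X, x != 0) -> (exists y : Y, y != 0) ->
  Sz_space (injective_tensor X Y) = xmax (Sz_space X) (Sz_space Y).
Proof.
move=> /id_op_neq0 X0 /id_op_neq0 Y0.
by rewrite -!Sz_op_id -Sz_tensor_op// tensor_op_id.
Qed.

End TensorOperators.

Theorem theorem1p3 (R : realType) (k : scalar_kind) :
  (forall (X X1 Y Y1 : completeNormedModType (scalars R k))
      (A : bounded_op X X1) (B : bounded_op Y Y1),
    A != 0 -> B != 0 ->
    Sz_op (tensor_op A B) = xmax (Sz_op A) (Sz_op B)) /\
  (forall X Y : completeNormedModType (scalars R k),
    (exists x : X, x != 0) -> (exists y : Y, y != 0) ->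
    Sz_space (injective_tensor X Y) = xmax (Sz_space X) (Sz_space Y)).
Proof.
by split=> *; [exact: Sz_tensor_op|exact: Sz_injective_tensor].
Qed.
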